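(* Let $X$ and $Y$ be Banach spaces over $\mathbb K\in\{\mathbb R,\mathbb C\}$ with $Y$ finite-dimensional. Then $$C_{\mathrm{NJ}}(X\widehat\otimes_{\varepsilon}Y)=2\iff \operatorname{Sq}(Y^*,X),\qquad C_{\mathrm{NJ}}(X\widehat\otimes_{\pi}Y)=2\iff\operatorname{Sq}(Y,X^* ).$$ Equivalently, each condition is witnessed by an exact operator square after passing to an ultrapower of the range; that is, $\operatorname{Sq}(Y^*,X)$ (respectively $\operatorname{Sq}(Y,X^* )$) holds if and only if there are an ultrapower $Z_{\mathcal U}$ of $Z=X$ (respectively of $Z=X^*$) and norm-one operators $A,B$ in $\mathcal L(Y^*,Z_{\mathcal U})$ (respectively in $\mathcal L(Y,Z_{\mathcal U})$) with $\|A+B\|=\|A-B\|=2$.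
   Context: For a Banach space $X$, the von Neumann--Jordan constant is $$C_{\mathrm{NJ}}(X)=\sup\left\{\frac{\|x+y\|^{2}+\|x-y\|^{2}}{2(\|x\|^{2}+\|y\|^{2})}: x,y\in X,\ (x,y)\neq(0,0)\right\}.$$ For Banach spaces $X,Y$ over $\mathbb K$, and $w=\sum_{j=1}^r x_j\otimes y_j$ in the algebraic tensor product $X\otimes Y$, the injective norm is $\|w\|_\varepsilon=\sup\{|\sum_{j} x^*(x_j)y^*(y_j)|: x^*\in B_{X^*},\,y^*\in B_{Y^*}\}$ and the projective norm is $\|w\|_\pi=\inf\{\sum_{j}\|x_j\|\|y_j\|: w=\sum_{j} x_j\otimes y_j\}$. The completions of $X\otimes Y$ for these norms are denoted $X\widehat\otimes_\varepsilon Y$ and $X\widehat\otimes_\pi Y$. $\mathcal L(E,Z)$ is the space of bounded linear operators $E\to Z$ with the operator norm, and $S_{\mathcal L(E,Z)}$ is its unit sphere. For a finite-dimensional space $E$ and a Banach space $Z$, $\operatorname{Sq}(E,Z)$ means that there exist sequences $A_k,B_k\in S_{\mathcal L(E,Z)}$ such that $\|A_k+B_k\|\to2$ and $\|A_k-B_k\|\to2$. $Z_{\mathcal U}$ denotes the Banach space ultrapower of $Z$ with respect to an ultrafilter $\mathcal U$ (bounded families modulo those with norm tending to $0$ along $\mathcal U$). *)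

(* Defs.v *)
From HB Require Import structures.
From mathcomp Require Import all_boot all_order all_algebra generic_quotient.
From mathcomp Require Import complex.
From mathcomp Require Import interval_inference boolp classical_sets functions.
From mathcomp Require Import filter reals.
From mathcomp Require Import topology normedtype sequences.

Set Implicit Arguments.
Unset Strict Implicit.
Unset Printing Implicit Defensive.

Import Order.TTheory GRing.Theory Num.Theory.
Import numFieldNormedType.Exports.

Local Open Scope classical_set_scope.
Local Open Scope ring_scope.

Inductive scalar_kind := RealScalars | ComplexScalars.

Definition scalar_field (R : realType) (k : scalar_kind) : numFieldType :=
  match k with RealScalars => R | ComplexScalars => R[i]%C end.

Section Scalars.
Variables (R : realType) (k : scalar_kind).

Definition re : scalar_field R k -> R :=
  match k return scalar_field R k -> R with
  | RealScalars => fun x => x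
  | ComplexScalars => fun z => complex.Re z
  end.

Definition of_real : R -> scalar_field R k :=
  match k return R -> scalar_field R k with
  | RealScalars => fun x => x
  | ComplexScalars => fun x => x%:C%C
  end.

Lemma of_realK x : re (of_real x) = x.
Proof. by rewrite /re /of_real; case: k. Qed.

Lemma of_real_inj : injective of_real.
Proof. by move=> x y /(congr1 re); rewrite !of_realK. Qed.

Lemma of_realD x y : of_real (x + y) = of_real x + of_real y.
Proof.
rewrite /of_real; case: k => //=; apply/eqP.
by rewrite eq_complex /= addr0 !eqxx.
Qed.

Lemma of_realM x y : of_real (x * y) = of_real x * of_real y.
Proof.
rewrite /of_real; case: k => //=; apply/eqP; rewrite eq_complex /=.
by rewrite !mulr0 mul0r subr0 addr0 !eqxx.
Qed.

Lemma of_real0 : of_real 0 = 0.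
Proof. by rewrite /of_real; case: k. Qed.

Lemma of_real1 : of_real 1 = 1.
Proof. by rewrite /of_real; case: k. Qed.

Lemma ler_of_real x y : (of_real x <= of_real y) = (x <= y).
Proof. by rewrite /of_real; case: k => //=; rewrite lecR. Qed.

Lemma norm_of_real x : `|of_real x| = of_real `|x|.
Proof.
rewrite /of_real; case: k => //=.
by rewrite [LHS]normc_def /= expr0n /= addr0 sqrtr_sqr.
Qed.

Lemma re0 : re 0 = 0.
Proof. by rewrite /re; case: k. Qed.

Lemma reD x y : re (x + y) = re x + re y.
Proof. by move: x y; rewrite /re; case: k => //= -[a b] [c d]. Qed.

Lemma re_ge0K (x : scalar_field R k) : 0 <= x -> of_real (re x) = x.
Proof.
move: x; rewrite /re /of_real; case: k => //= -[a b].
by rewrite lecE /= => /andP[/eqP -> _].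
Qed.

End Scalars.

Section RealNorm.
Variables (R : realType) (k : scalar_kind).
Local Notation K := (scalar_field R k).

(* The library norm takes its values in the scalar field; [nrm] is the same
   norm read in [R]. *)
Definition nrm (V : normedModType K) (x : V) : R := re `|x|.

Lemma of_real_nrm (V : normedModType K) (x : V) : of_real k (nrm x) = `|x|.
Proof. exact: re_ge0K. Qed.

Section Theory.
Variable V : normedModType K.
Implicit Types x y : V.

Lemma nrm_ge0 x : 0 <= nrm x.
Proof. by rewrite -(ler_of_real k) of_real0 of_real_nrm. Qed.

Lemma nrmD x y : nrm (x + y) <= nrm x + nrm y.
Proof. by rewrite -(ler_of_real k) of_realD !of_real_nrm ler_normD. Qed.

Lemma nrmN x : nrm (- x) = nrm x.
Proof. by rewrite /nrm normrN. Qed.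

Lemma nrm0 : nrm (0 : V) = 0.
Proof. by rewrite /nrm normr0 re0. Qed.

Lemma nrm_eq0 x : nrm x = 0 -> x = 0.
Proof.
move=> x0; apply/eqP; rewrite -normr_eq0; apply/eqP.
by rewrite -of_real_nrm x0 of_real0.
Qed.

Lemma nrmZ (a : K) x : nrm (a *: x) = nrm (a : K^o) * nrm x.
Proof.
apply: (@of_real_inj R k).
by rewrite of_realM !of_real_nrm; exact: normrZ.
Qed.

Lemma nrm_of_real (c : R) : nrm (of_real k c : K^o) = `|c|.
Proof.
apply: (@of_real_inj R k).
by rewrite of_real_nrm -norm_of_real.
Qed.

Lemma nrm_scalarM (a b : K) : nrm (a * b : K^o) = nrm (a : K^o) * nrm (b : K^o).
Proof.
apply: (@of_real_inj R k).
by rewrite of_realM !of_real_nrm normrM.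
Qed.

End Theory.

Record seminorm (V : lmodType K) := Seminorm {
  seminorm_fun :> V -> R;
  seminormD : forall x y,
    seminorm_fun (x + y) <= seminorm_fun x + seminorm_fun y;
  seminormZ : forall a x,
    seminorm_fun (a *: x) = nrm (a : K^o) * seminorm_fun x
}.

Section SeminormTheory.
Variables (V : lmodType K) (p : seminorm V).

Lemma seminorm0 : p 0 = 0.
Proof. by rewrite -(scale0r 0) seminormZ nrm0 mul0r. Qed.

Lemma seminormN x : p (- x) = p x.
Proof.
rewrite -scaleN1r seminormZ nrmN /nrm normr1.
by rewrite -(of_real1 R k) of_realK mul1r.
Qed.

Lemma seminorm_ge0 x : 0 <= p x.
Proof.
have := seminormD p x (- x); rewrite subrr seminorm0 seminormN.
by rewrite -mulr2n pmulrn_lge0.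
Qed.

Lemma seminorm_subC x y : p (x - y) = p (y - x).
Proof. by rewrite -seminormN opprB. Qed.

Lemma seminorm_dist x y : `|p x - p y| <= p (x - y).
Proof.
rewrite ler_norml lerBrDr lerBlDr; apply/andP; split; last first.
  by have := seminormD p (x - y) y; rewrite subrK.
have := seminormD p (y - x) x; rewrite subrK (seminorm_subC y x) => yx.
by rewrite addrC lerBlDr addrC.
Qed.

Lemma seminorm_null x y : p (x - y) = 0 -> p x = p y.
Proof.
by move=> xy; have := seminorm_dist x y; rewrite xy normr_le0 subr_eq0 => /eqP.
Qed.

Definition sep_rel : rel V := fun x y => p (x - y) == 0.

Lemma sep_rel_equiv : equiv_class_of sep_rel.
Proof.
have tri x y z : sep_rel x y -> sep_rel y z -> sep_rel x z.
  rewrite /sep_rel => /eqP xy /eqP yz; rewrite eq_le seminorm_ge0 andbT.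
  by rewrite -(subrKA y) (le_trans (seminormD _ _ _))// xy yz addr0.
apply: EquivClass => [x|x y|y x z]; first by rewrite /sep_rel subrr seminorm0.
  by rewrite /sep_rel seminorm_subC.
exact: tri.
Qed.

Canonical sep_equiv : equiv_rel V := EquivRelPack sep_rel_equiv.

(* [V / ker p], normed by [p]. *)
Definition sep := {eq_quot sep_equiv}%qT.

HB.instance Definition _ := EqQuotient.on sep.
HB.instance Definition _ := Choice.on sep.

Local Open Scope quotient_scope.

Definition to_sep (x : V) : sep := \pi_sep x.

Lemma to_sepP x y : to_sep x = to_sep y <-> p (x - y) = 0.
Proof. by split=> [/eqmodP/eqP|xy]; [|apply/eqmodP/eqP]. Qed.

Lemma to_sep_repr (c : sep) : to_sep (repr c) = c.
Proof. exact: reprK. Qed.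

Lemma sepW (P : sep -> Prop) : (forall x, P (to_sep x)) -> forall c, P c.
Proof. by move=> H c; rewrite -(to_sep_repr c). Qed.

Lemma repr_to_sep x : p (repr (to_sep x) - x) = 0.
Proof. by apply/to_sepP; rewrite to_sep_repr. Qed.

Definition sep_add (c d : sep) : sep := to_sep (repr c + repr d).
Definition sep_opp (c : sep) : sep := to_sep (- repr c).
Definition sep_scale (a : K) (c : sep) : sep := to_sep (a *: repr c).
Definition sep_norm (c : sep) : R := p (repr c).

Lemma sep_addE x y : sep_add (to_sep x) (to_sep y) = to_sep (x + y).
Proof.
apply/to_sepP/eqP; rewrite eq_le seminorm_ge0 andbT opprD addrACA.
by rewrite (le_trans (seminormD _ _ _))// !repr_to_sep addr0.
Qed.

Lemma sep_oppE x : sep_opp (to_sep x) = to_sep (- x).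
Proof. by apply/to_sepP; rewrite -opprD seminormN repr_to_sep. Qed.

Lemma sep_scaleE a x : sep_scale a (to_sep x) = to_sep (a *: x).
Proof. by apply/to_sepP; rewrite -scalerBr seminormZ repr_to_sep mulr0. Qed.

Lemma sep_normE x : sep_norm (to_sep x) = p x.
Proof. exact/seminorm_null/repr_to_sep. Qed.

Let addA : associative sep_add.
Proof.
by elim/sepW=> x; elim/sepW=> y; elim/sepW=> z; rewrite !sep_addE addrA.
Qed.

Let addC : commutative sep_add.
Proof. by elim/sepW=> x; elim/sepW=> y; rewrite !sep_addE addrC. Qed.

Let add0 : left_id (to_sep 0) sep_add.
Proof. by elim/sepW=> x; rewrite sep_addE add0r. Qed.

Let addN : left_inverse (to_sep 0) sep_opp sep_add.
Proof. by elim/sepW=> x; rewrite sep_oppE sep_addE addNr. Qed.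

HB.instance Definition _ := GRing.isZmodule.Build sep addA addC add0 addN.

Lemma to_sepD x y : to_sep (x + y) = to_sep x + to_sep y.
Proof. by rewrite -sep_addE. Qed.

Let scaleA a b c : sep_scale a (sep_scale b c) = sep_scale (a * b) c.
Proof. by elim/sepW: c => x; rewrite !sep_scaleE scalerA. Qed.

Let scale1 : left_id 1 sep_scale.
Proof. by elim/sepW=> x; rewrite sep_scaleE scale1r. Qed.

Let scaleDr : right_distributive sep_scale +%R.
Proof.
move=> a; elim/sepW=> x; elim/sepW=> y.
by rewrite -to_sepD !sep_scaleE -to_sepD scalerDr.
Qed.

Let scaleDl c : {morph sep_scale^~ c : a b / a + b}.
Proof. by elim/sepW: c => x a b; rewrite !sep_scaleE -to_sepD scalerDl. Qed.

HB.instance Definition _ :=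
  GRing.Zmodule_isLmodule.Build K sep scaleA scale1 scaleDr scaleDl.

Lemma to_sepZ a x : to_sep (a *: x) = a *: to_sep x.
Proof. by rewrite -sep_scaleE. Qed.

Lemma to_sep_linear : linear to_sep.
Proof. by move=> a x y; rewrite to_sepD to_sepZ. Qed.

HB.instance Definition _ :=
  GRing.isLinear.Build K V sep *:%R to_sep to_sep_linear.

Let normD (c d : sep) :
  of_real k (sep_norm (c + d)) <=
  of_real k (sep_norm c) + of_real k (sep_norm d).
Proof.
elim/sepW: c => x; elim/sepW: d => y.
by rewrite -to_sepD !sep_normE -of_realD ler_of_real seminormD.
Qed.

Let normZ (a : K) (c : sep) :
  of_real k (sep_norm (a *: c)) = `|a| * of_real k (sep_norm c).
Proof.
elim/sepW: c => x.
by rewrite -to_sepZ !sep_normE seminormZ of_realM (of_real_nrm (a : K^o)).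
Qed.

Let norm_eq0 (c : sep) : of_real k (sep_norm c) = 0 -> c = 0.
Proof.
elim/sepW: c => x; rewrite sep_normE => /(congr1 (@re R k)).
by rewrite of_realK re0 => px; apply/to_sepP; rewrite subr0.
Qed.

HB.instance Definition _ := Lmodule_isNormed.Build K sep normD normZ norm_eq0.

Lemma nrm_to_sep x : nrm (to_sep x) = p x.
Proof. by rewrite -sep_normE -[RHS](of_realK k). Qed.

End SeminormTheory.
End RealNorm.

Section BoundedOperators.
Variables (R : realType) (k : scalar_kind).
Local Notation K := (scalar_field R k).

Lemma nrmZ_of_le (V : lmodType K) (p : V -> R) :
  (forall x, 0 <= p x) ->
  (forall (a : K) x, p (a *: x) <= nrm (a : K^o) * p x) ->
  forall (a : K) x, p (a *: x) = nrm (a : K^o) * p x.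
Proof.
move=> p0 pZ a x; apply/eqP; rewrite eq_le pZ /=.
have [->|a0] := eqVneq a 0; first by rewrite nrm0 mul0r.
have na0 : 0 < nrm (a : K^o).
  by rewrite lt_neqAle nrm_ge0 andbT eq_sym; apply: contra_neq a0 => /nrm_eq0.
rewrite mulrC -ler_pdivlMr// mulrC -{1}(scale1r x) -(mulVf a0) -scalerA.
rewrite (le_trans (pZ _ _))//.
suff -> : nrm (a^-1 : K^o) = (nrm (a : K^o))^-1 by [].
apply: (mulIf (lt0r_neq0 na0)); rewrite mulVf ?lt0r_neq0//.
by rewrite -nrm_scalarM mulVf// /nrm normr1 -(of_real1 R k) of_realK.
Qed.

Variables E Z : normedModType K.

Definition bounded_linear : {pred E -> Z} := fun f =>
  `[< linear f /\ exists M : R, forall x, nrm (f x) <= M * nrm x >].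

Record bounded_op := BoundedOp {
  bop_fun :> E -> Z;
  bop_subproof : bop_fun \in bounded_linear }.

HB.instance Definition _ := [isSub for bop_fun].
HB.instance Definition _ := [Choice of bounded_op by <:].

Lemma bounded_linear_submod : submod_closed bounded_linear.
Proof.
split=> [|a f g].
  apply/asboolP; split; first by move=> b x y; rewrite /= scaler0 addr0.
  by exists 0 => x; rewrite nrm0 mul0r.
move=> /asboolP[lf [M Mf]] /asboolP[lg [N Ng]]; apply/asboolP; split.
  move=> b x y; rewrite !fctE lf lg !scalerDr addrACA.
  by congr (_ + _ + _); rewrite !scalerA mulrC.
exists (nrm (a : K^o) * M + N) => x; rewrite !fctE (le_trans (nrmD _ _))//.
by rewrite mulrDl lerD// nrmZ -mulrA ler_wpM2l// nrm_ge0.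
Qed.

HB.instance Definition _ :=
  GRing.isSubmodClosed.Build K (E -> Z) bounded_linear bounded_linear_submod.
HB.instance Definition _ := [SubChoice_isSubLmodule of bounded_op by <:].

Implicit Types f g : bounded_op.

Lemma bop_linear f : linear f.
Proof. by case: f => f /= /asboolP[]. Qed.

HB.instance Definition _ f := GRing.isLinear.Build K E Z *:%R f (@bop_linear f).

Lemma bop_bounded f : exists M : R, forall x, nrm (f x) <= M * nrm x.
Proof. by case: f => f /= /asboolP[]. Qed.

Lemma bopD f g x : (f + g) x = f x + g x.
Proof. by []. Qed.

Lemma bopN f x : (- f) x = - f x.
Proof. by []. Qed.

Lemma bopZ (a : K) f x : (a *: f) x = a *: f x.
Proof. by []. Qed.

Lemma bop_eqP f g : f =1 g -> f = g.
Proof. by move=> fg; apply/val_inj/funext. Qed.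

Definition opnorm f : R := sup [set nrm (f x) | x in [set x | nrm x <= 1]].

Lemma opnorm_has_sup f : has_sup [set nrm (f x) | x in [set x | nrm x <= 1]].
Proof.
split; first by exists (nrm (f 0)); exists 0 => //=; rewrite nrm0 ler01.
have [M Mf] := bop_bounded f; exists `|M| => _ [x /= x1 <-].
rewrite (le_trans (Mf x))// (le_trans (ler_wpM2r (nrm_ge0 _) (ler_norm M)))//.
by rewrite ler_piMr.
Qed.

Lemma opnorm_ge0 f : 0 <= opnorm f.
Proof.
apply: (@le_trans _ _ (nrm (f 0))); first exact: nrm_ge0.
apply: ub_le_sup; first by case: (opnorm_has_sup f).
by exists 0 => //=; rewrite nrm0 ler01.
Qed.

Lemma le_opnorm f x : nrm (f x) <= opnorm f * nrm x.
Proof.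
have [->|x0] := eqVneq x 0; first by rewrite linear0 !nrm0 mulr0.
have nx0 : 0 < nrm x.
  by rewrite lt_neqAle nrm_ge0 andbT eq_sym; apply: contra_neq x0 => /nrm_eq0.
rewrite -ler_pdivrMr// mulrC.
have nV : nrm (of_real k (nrm x)^-1 : K^o) = (nrm x)^-1.
  by rewrite nrm_of_real ger0_norm// invr_ge0 nrm_ge0.
rewrite -{1}nV -nrmZ -linearZ; apply: ub_le_sup.
  by case: (opnorm_has_sup f).
by exists (of_real k (nrm x)^-1 *: x); rewrite //= nrmZ nV mulVf ?lt0r_neq0.
Qed.

Lemma opnorm_le f (M : R) :
  0 <= M -> (forall x, nrm (f x) <= M * nrm x) -> opnorm f <= M.
Proof.
move=> M0 Mf; apply: ge_sup; first by case: (opnorm_has_sup f).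
by move=> _ [x /= x1 <-]; rewrite (le_trans (Mf x))// ler_piMr.
Qed.

Lemma opnormD f g : opnorm (f + g) <= opnorm f + opnorm g.
Proof.
apply: opnorm_le; first by rewrite addr_ge0 ?opnorm_ge0.
by move=> x; rewrite bopD (le_trans (nrmD _ _))// mulrDl lerD ?le_opnorm.
Qed.

Lemma opnormZ (a : K) f : opnorm (a *: f) = nrm (a : K^o) * opnorm f.
Proof.
apply: nrmZ_of_le => [{}f|{}a {}f]; first exact: opnorm_ge0.
apply: opnorm_le => [|x]; first by rewrite mulr_ge0 ?nrm_ge0 ?opnorm_ge0.
by rewrite bopZ nrmZ -mulrA ler_wpM2l ?nrm_ge0 ?le_opnorm.
Qed.

Let normD f g :
  of_real k (opnorm (f + g)) <= of_real k (opnorm f) + of_real k (opnorm g).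
Proof. by rewrite -of_realD ler_of_real opnormD. Qed.

Let normZ (a : K) f : of_real k (opnorm (a *: f)) = `|a| * of_real k (opnorm f).
Proof. by rewrite opnormZ of_realM (of_real_nrm (a : K^o)). Qed.

Let norm_eq0 f : of_real k (opnorm f) = 0 -> f = 0.
Proof.
move=> /(congr1 (@re R k)); rewrite of_realK re0 => f0; apply: bop_eqP => x.
apply: nrm_eq0; apply/eqP; rewrite eq_le nrm_ge0 andbT.
by rewrite (le_trans (le_opnorm f x))// f0 mul0r.
Qed.

HB.instance Definition _ :=
  Lmodule_isNormed.Build K bounded_op normD normZ norm_eq0.

Lemma nrm_bop f : nrm f = opnorm f.
Proof. exact: of_realK. Qed.

End BoundedOperators.

Definition dual_space (R : realType) (k : scalar_kind)
  (E : normedModType (scalar_field R k)) : normedModType (scalar_field R k) :=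
  bounded_op E (scalar_field R k)^o.

(* An element [x (x) y] is encoded as the evaluation [B |-> B x y] on bilinear
   forms [B] on [X * Y]; the algebraic tensor product is the span of these
   evaluations, because bilinear forms separate its points. *)
Section Tensor.
Variables (K : fieldType) (X Y : lmodType K).

Definition is_tensor : {pred {bilinear X -> Y -> K^o} -> K^o} := fun w =>
  `[< exists s : seq (X * Y), w = fun B => \sum_(u <- s) B u.1 u.2 >].

Record tensor := Tensor {
  tensor_fun :> {bilinear X -> Y -> K^o} -> K^o;
  tensor_subproof : tensor_fun \in is_tensor }.

HB.instance Definition _ := [isSub for tensor_fun].
HB.instance Definition _ := [Choice of tensor by <:].

Lemma is_tensor_submod : submod_closed is_tensor.
Proof.
split=> [|a w z /asboolP[s ->] /asboolP[t ->]].
  by apply/asboolP; exists [::]; apply/funext => B; rewrite big_nil.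
apply/asboolP; exists ([seq (a *: u.1, u.2) | u <- s] ++ t).
apply/funext => B; rewrite big_cat big_map !fctE /=; congr (_ + _).
by rewrite scaler_sumr; apply: eq_bigr => u _; rewrite linearZl_LR.
Qed.

HB.instance Definition _ := GRing.isSubmodClosed.Build K
  ({bilinear X -> Y -> K^o} -> K^o) is_tensor is_tensor_submod.
HB.instance Definition _ := [SubChoice_isSubLmodule of tensor by <:].

Lemma tprod_subproof x y :
  (fun B : {bilinear X -> Y -> K^o} => B x y) \in is_tensor.
Proof.
by apply/asboolP; exists [:: (x, y)]; apply/funext => B; rewrite big_seq1.
Qed.

Definition tprod (x : X) (y : Y) : tensor := Tensor (tprod_subproof x y).

Definition tsum (s : seq (X * Y)) : tensor := \sum_(u <- s) tprod u.1 u.2.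

Lemma tsumE s B : tsum s B = \sum_(u <- s) B u.1 u.2.
Proof.
rewrite /tsum; elim: s => [|u s IH]; first by rewrite !big_nil.
by rewrite !big_cons -IH.
Qed.

Lemma tensor_eqP (w z : tensor) : w =1 z -> w = z.
Proof. by move=> wz; apply/val_inj/funext. Qed.

Lemma tensorD (w z : tensor) B : (w + z) B = w B + z B.
Proof. by []. Qed.

Lemma tensorZ a (w : tensor) B : (a *: w) B = a *: w B.
Proof. by []. Qed.

Lemma tensor_tsum w : exists s, w = tsum s.
Proof.
case: w => w wP; have /asboolP[s ws] := wP; exists s.
by apply: tensor_eqP => B; rewrite tsumE /= ws.
Qed.

Lemma tsum_cat s t : tsum (s ++ t) = tsum s + tsum t.
Proof. by rewrite /tsum big_cat. Qed.

Lemma tsumZ a s : a *: tsum s = tsum [seq (a *: u.1, u.2) | u <- s].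
Proof.
apply: tensor_eqP => B; rewrite tsumE big_map.
rewrite tensorZ tsumE scaler_sumr; apply: eq_bigr => u _.
by rewrite linearZl_LR.
Qed.

End Tensor.

Section TensorNorms.
Variables (R : realType) (k : scalar_kind).
Local Notation K := (scalar_field R k).
Variables X Y : normedModType K.

Definition form_prod (f : dual_space X) (g : dual_space Y) (x : X) (y : Y) :
  K^o :=
  (f x : K) * (g y : K).

Lemma form_prod_bilinear f g : bilinear_for *:%R *:%R (form_prod f g).
Proof.
split=> [y|x] a u v; rewrite /form_prod linearP.
  by rewrite mulrDl -mulrA.
by rewrite mulrDr mulrCA.
Qed.

HB.instance Definition _ f g := bilinear_isBilinear.Build K X Y K^o *:%R *:%R
  (form_prod f g) (form_prod_bilinear f g).

(* For [w = \sum_(u <- s) u.1 (x) u.2], evaluating [w] at [form_prod f g] gives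
   [\sum_(u <- s) f u.1 * g u.2]; see [inj_normE]. *)
Definition inj_norm (w : tensor X Y) : R :=
  sup [set r | exists (f : dual_space X) (g : dual_space Y),
    [/\ nrm f <= 1, nrm g <= 1 & r = nrm (w (form_prod f g))]].

Lemma inj_normE (s : seq (X * Y)) :
  inj_norm (tsum s) = sup [set r | exists (f : dual_space X) (g : dual_space Y),
    [/\ nrm f <= 1, nrm g <= 1 &
        r = nrm (\sum_(u <- s) (f u.1 : K) * (g u.2 : K) : K^o)]].
Proof.
rewrite /inj_norm; congr sup; apply/seteqP.
by split=> r [f [g [f1 g1 ->]]]; exists f, g; rewrite tsumE.
Qed.

Definition proj_norm (w : tensor X Y) : R :=
  inf [set \sum_(u <- s) nrm u.1 * nrm u.2 |
       s in [set s : seq (X * Y) | w = tsum s]].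


Lemma inj_has_sup (w : tensor X Y) : has_sup
  [set r | exists (f : dual_space X) (g : dual_space Y),
    [/\ nrm f <= 1, nrm g <= 1 & r = nrm (w (form_prod f g))]].
Proof.
split; first by exists (nrm (w (form_prod 0 0))), 0, 0; split; rewrite ?nrm0.
have [s ->] := tensor_tsum w; exists (\sum_(u <- s) nrm u.1 * nrm u.2).
move=> _ [f [g [f1 g1 ->]]]; rewrite tsumE.
elim: s => [|u s IH]; first by rewrite !big_nil nrm0.
rewrite !big_cons (le_trans (nrmD _ _))// lerD// /form_prod nrm_scalarM.
have le_nrm (V : normedModType K) (h : dual_space V) x :
    nrm h <= 1 -> nrm (h x) <= nrm x.
  move=> h1; apply: (le_trans (le_opnorm h x)).
  by rewrite ler_piMl ?nrm_ge0// -nrm_bop.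
by rewrite ler_pM ?nrm_ge0// le_nrm.
Qed.

Lemma le_inj_norm (w : tensor X Y) (f : dual_space X) (g : dual_space Y) :
  nrm f <= 1 -> nrm g <= 1 -> nrm (w (form_prod f g)) <= inj_norm w.
Proof.
by move=> f1 g1; apply: ub_le_sup; [case: (inj_has_sup w)|exists f, g].
Qed.

Lemma inj_norm_le (w : tensor X Y) (M : R) :
  (forall (f : dual_space X) (g : dual_space Y), nrm f <= 1 -> nrm g <= 1 ->
    nrm (w (form_prod f g)) <= M) -> inj_norm w <= M.
Proof.
move=> wM; apply: ge_sup; first by case: (inj_has_sup w).
by move=> _ [f [g [f1 g1 ->]]]; exact: wM.
Qed.

Lemma inj_norm_ge0 (w : tensor X Y) : 0 <= inj_norm w.
Proof.
apply: (@le_trans _ _ (nrm (w (form_prod 0 0)))); first exact: nrm_ge0.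
by apply: le_inj_norm; rewrite nrm0.
Qed.

Lemma inj_normD (w z : tensor X Y) :
  inj_norm (w + z) <= inj_norm w + inj_norm z.
Proof.
apply: inj_norm_le => f g f1 g1.
by rewrite tensorD (le_trans (nrmD _ _))// lerD// le_inj_norm.
Qed.

Lemma inj_normZ (a : K) (w : tensor X Y) :
  inj_norm (a *: w) = nrm (a : K^o) * inj_norm w.
Proof.
apply: nrmZ_of_le => [{}w|{}a {}w]; first exact: inj_norm_ge0.
apply: inj_norm_le => f g f1 g1.
by rewrite tensorZ nrmZ ler_wpM2l ?nrm_ge0 ?le_inj_norm.
Qed.

Definition inj_seminorm := Seminorm inj_normD inj_normZ.

Lemma proj_has_inf (w : tensor X Y) : has_inf
  [set \sum_(u <- s) nrm u.1 * nrm u.2 |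
   s in [set s : seq (X * Y) | w = tsum s]].
Proof.
have [s ws] := tensor_tsum w; split.
  by exists (\sum_(u <- s) nrm u.1 * nrm u.2), s.
by exists 0 => _ [t _ <-]; apply: sumr_ge0 => u _; rewrite mulr_ge0 ?nrm_ge0.
Qed.

Lemma proj_norm_le (s : seq (X * Y)) :
  proj_norm (tsum s) <= \sum_(u <- s) nrm u.1 * nrm u.2.
Proof. by apply: ge_inf; [case: (proj_has_inf (tsum s))|exists s]. Qed.

Lemma le_proj_norm (w : tensor X Y) (M : R) :
  (forall s, w = tsum s -> M <= \sum_(u <- s) nrm u.1 * nrm u.2) ->
  M <= proj_norm w.
Proof.
move=> wM; apply: lb_le_inf; first by case: (proj_has_inf w).
by move=> _ [s /= ws <-]; exact: wM.
Qed.

Lemma proj_norm_ge0 (w : tensor X Y) : 0 <= proj_norm w.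
Proof.
apply: le_proj_norm => s _; apply: sumr_ge0 => u _.
by rewrite mulr_ge0 ?nrm_ge0.
Qed.

Lemma proj_normD (w z : tensor X Y) :
  proj_norm (w + z) <= proj_norm w + proj_norm z.
Proof.
rewrite -lerBlDr; apply: le_proj_norm => s ->.
rewrite lerBlDr -lerBlDl; apply: le_proj_norm => t ->.
by rewrite lerBlDl -tsum_cat (le_trans (proj_norm_le _))// big_cat.
Qed.

Lemma proj_normZ (a : K) (w : tensor X Y) :
  proj_norm (a *: w) = nrm (a : K^o) * proj_norm w.
Proof.
apply: nrmZ_of_le => [{}w|{}a {}w]; first exact: proj_norm_ge0.
have H s : w = tsum s ->
    proj_norm (a *: w) <= nrm (a : K^o) * \sum_(u <- s) nrm u.1 * nrm u.2.
  move=> ->; rewrite tsumZ (le_trans (proj_norm_le _))// big_map mulr_sumr.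
  by apply: ler_sum => u _; rewrite /= nrmZ mulrA.
have [a0|a0] := eqVneq (nrm (a : K^o)) 0.
  by have [s /H] := tensor_tsum w; rewrite a0 !mul0r.
have {}a0 : 0 < nrm (a : K^o) by rewrite lt_neqAle eq_sym a0 nrm_ge0.
rewrite mulrC -ler_pdivrMr//; apply: le_proj_norm => s /H.
by rewrite ler_pdivrMr// mulrC.
Qed.

Definition proj_seminorm := Seminorm proj_normD proj_normZ.

End TensorNorms.

Section Completion.
Variables (R : realType) (k : scalar_kind).
Local Notation K := (scalar_field R k).
Variables (V : lmodType K) (p : seminorm V).

Definition is_cauchy : {pred nat -> V} := fun u =>
  `[< forall e : R, 0 < e ->
      exists N, forall m n, (N <= m)%N -> (N <= n)%N -> p (u m - u n) < e >].

Record cauchy_seq := CauchySeq {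
  cauchy_seq_fun :> nat -> V;
  cauchy_seq_subproof : cauchy_seq_fun \in is_cauchy }.

HB.instance Definition _ := [isSub for cauchy_seq_fun].
HB.instance Definition _ := [Choice of cauchy_seq by <:].

Lemma is_cauchy_submod : submod_closed is_cauchy.
Proof.
split=> [|a u v /asboolP cu /asboolP cv].
  by apply/asboolP => e e0; exists 0%N => m n _ _; rewrite subrr seminorm0.
apply/asboolP => e e0; set M := nrm (a : K^o) + 1.
have M0 : 0 < M by rewrite ltr_wpDl ?nrm_ge0.
have [Nu Hu] := cu (e / 2 / M) (divr_gt0 (divr_gt0 e0 (ltr0Sn R 1)) M0).
have [Nv Hv] := cv (e / 2) (divr_gt0 e0 (ltr0Sn R 1)).
exists (maxn Nu Nv) => m n; rewrite !geq_max => /andP[um vm] /andP[un vn].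
rewrite !fctE opprD addrACA -scalerBr (le_lt_trans (seminormD _ _ _))//.
rewrite (splitr e) ler_ltD ?Hv// seminormZ.
apply: (@le_trans _ _ (M * p (u m - u n))).
  by rewrite ler_wpM2r ?seminorm_ge0// lerDl.
by rewrite mulrC -ler_pdivlMr// ltW// Hu.
Qed.

HB.instance Definition _ :=
  GRing.isSubmodClosed.Build K (nat -> V) is_cauchy is_cauchy_submod.
HB.instance Definition _ := [SubChoice_isSubLmodule of cauchy_seq by <:].

Definition cauchy_norm (u : cauchy_seq) : R := lim (p (u n) @[n --> \oo]).

Lemma cauchy_seqP (u : cauchy_seq) (e : R) : 0 < e ->
  exists N, forall m n, (N <= m)%N -> (N <= n)%N -> p (u m - u n) < e.
Proof. by case: u => u /= /asboolP; exact. Qed.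

Lemma cauchy_norm_cvg (u : cauchy_seq) :
  p (u n) @[n --> \oo] --> cauchy_norm u.
Proof.
apply: cauchy_cvg; apply: cauchy_exP => e e0.
have [N HN] := cauchy_seqP u e0; exists (p (u N)); exists N => // n /= Nn.
by rewrite /ball/= (le_lt_trans (seminorm_dist _ _ _))// HN.
Qed.

Arguments cauchy_norm_cvg : clear implicits.

Lemma cauchy_normD (u v : cauchy_seq) :
  cauchy_norm (u + v) <= cauchy_norm u + cauchy_norm v.
Proof.
have uv : p (u n) + p (v n) @[n --> \oo] --> cauchy_norm u + cauchy_norm v.
  by apply: cvgD; exact: cauchy_norm_cvg.
apply: (ler_cvg_to (cauchy_norm_cvg (u + v)) uv).
by apply: nearW => n; exact: seminormD.
Qed.

Lemma cauchy_normZ (a : K) (u : cauchy_seq) :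
  cauchy_norm (a *: u) = nrm (a : K^o) * cauchy_norm u.
Proof.
apply/cvg_lim => //.
rewrite (_ : (fun n => _) = fun n => nrm (a : K^o) * p (u n)).
  exact: cvgMl_tmp (cauchy_norm_cvg u).
by apply/funext => n; exact: seminormZ.
Qed.

Definition cauchy_seminorm := Seminorm cauchy_normD cauchy_normZ.

(* Cauchy sequences modulo those whose seminorm tends to 0. *)
Definition completion := sep cauchy_seminorm.

HB.instance Definition _ := NormedModule.on completion.

Lemma cst_cauchy (x : V) : (fun=> x) \in is_cauchy.
Proof.
by apply/asboolP => e e0; exists 0%N => m n _ _; rewrite subrr seminorm0.
Qed.

Definition to_completion (x : V) : completion :=
  to_sep cauchy_seminorm (CauchySeq (cst_cauchy x)).

Lemma to_completion_linear : linear to_completion.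
Proof.
move=> a x y; rewrite /to_completion -to_sepZ -to_sepD; congr to_sep.
exact/val_inj/funext.
Qed.

HB.instance Definition _ :=
  GRing.isLinear.Build K V completion *:%R to_completion to_completion_linear.

Lemma nrm_to_completion x : nrm (to_completion x) = p x.
Proof. by rewrite nrm_to_sep /= /cauchy_norm /= lim_cst. Qed.

Lemma to_completion_approx (u : cauchy_seq) (e : R) : 0 < e ->
  exists N, forall n, (N <= n)%N ->
    nrm ((to_sep cauchy_seminorm u : completion) - to_completion (u n)) <= e.
Proof.
move=> e0; have [N HN] := cauchy_seqP u e0; exists N => n Nn.
set v := CauchySeq (cst_cauchy (u n)).
rewrite /to_completion -/v -[X in nrm X]/(to_sep _ u - to_sep _ v).
rewrite -linearB nrm_to_sep.
apply: (ler_cvg_to (cauchy_norm_cvg (u - v)) (cvg_cst e)).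
by exists N => // m /= Nm; rewrite ltW// HN.
Qed.

Lemma to_completion_dense (c : completion) (e : R) : 0 < e ->
  exists x, nrm (c - to_completion x) <= e.
Proof.
move=> e0; elim/sepW: c => u.
by have [N /(_ N (leqnn N))] := to_completion_approx u e0; exists (u N).
Qed.


Lemma completion_cauchy_cvg (F : set_system completion) :
  ProperFilter F -> cauchy F -> cvg F.
Proof.
move=> FF /cauchyP Fc.
have Fsmall (e : R) : 0 < e ->
    exists x, F [set c | nrm (c - to_completion x) <= e].
  move=> e0; have e20 : 0 < e / 2 by rewrite divr_gt0.
  have e'0 : 0 < of_real k (e / 2).
    by rewrite lt_neqAle -[X in X <= _](of_real0 R k) ler_of_real ltW// andbT
      -(of_real0 R k) (inj_eq (@of_real_inj R k)) lt_eqF.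
  have [c Fb] := Fc _ e'0.
  have [x cx] := to_completion_dense c e20.
  exists x; apply: filterS Fb => d; rewrite -ball_normE /= => cd.
  rewrite (splitr e) -(subrKA c) (le_trans (nrmD _ _))// lerD//.
  by rewrite -nrmN opprB -(ler_of_real k) of_real_nrm ltW.
have F_le x y (a b : R) : F [set c | nrm (c - to_completion x) <= a] ->
    F [set c | nrm (c - to_completion y) <= b] -> p (x - y) <= a + b.
  move=> Fx Fy; have [c [/= cx cy]] := filter_ex (filterI Fx Fy).
  rewrite -nrm_to_completion linearB -(subrKA c) (le_trans (nrmD _ _))//.
  by rewrite lerD// -nrmN opprB.
have inv0 n : (0 : R) < n.+1%:R^-1 by rewrite invr_gt0.
have [x Fx] := choice (fun n : nat => Fsmall _ (inv0 n)).
have small (e : R) : 0 < e ->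
    exists N, forall n, (N <= n)%N -> n.+1%:R^-1 < e.
  by move=> e0; have [N _ HN] := near_infty_natSinv_lt (PosNum e0); exists N.
have xc : x \in is_cauchy.
  apply/asboolP => e e0; have [N HN] := small _ (divr_gt0 e0 (ltr0Sn R 1)).
  exists N => m n Nm Nn; rewrite (le_lt_trans (F_le _ _ _ _ (Fx m) (Fx n)))//.
  by rewrite (splitr e) ltrD ?HN.
pose c : completion := to_sep cauchy_seminorm (CauchySeq xc).
apply/cvg_ex; exists c; apply/cvgrPdist_le => e e0.
have eR : of_real k (re e) = e by apply: re_ge0K; exact: ltW.
have re0 : 0 < re e.
  rewrite lt_neqAle -(ler_of_real k) of_real0 eR ltW// andbT.
  by apply: contraTneq e0 => e0; rewrite -eR -e0 of_real0 ltxx.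
have re20 : 0 < re e / 2 by rewrite divr_gt0.
have [N1 HN1] := to_completion_approx (CauchySeq xc) re20.
have [N2 HN2] := small _ re20.
set n := maxn N1 N2; apply: filterS (Fx n) => d /= dx.
rewrite -eR -of_real_nrm ler_of_real (splitr (re e)).
rewrite -(subrKA (to_completion (x n))) (le_trans (nrmD _ _))// lerD//.
  by apply: HN1; rewrite leq_maxl.
by rewrite -nrmN opprB (le_trans dx)// ltW// HN2// leq_maxr.
Qed.

HB.instance Definition _ :=
  Uniform_isComplete.Build completion completion_cauchy_cvg.

End Completion.

Section CompletedTensor.
Variables (R : realType) (k : scalar_kind).
Variables X Y : normedModType (scalar_field R k).

Definition inj_tensor : completeNormedModType (scalar_field R k) :=
  completion (inj_seminorm X Y).

Definition proj_tensor : completeNormedModType (scalar_field R k) :=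
  completion (proj_seminorm X Y).

End CompletedTensor.

Section Ultrapower.
Variables (R : realType) (k : scalar_kind).
Local Notation K := (scalar_field R k).
Variables (I : Type) (U : set_system I) (hU : UltraFilter U).
Variable Z : normedModType K.

Let UF : ProperFilter U := ultra_proper.

Definition is_bounded : {pred I -> Z} := fun z =>
  `[< exists M : R, forall i, nrm (z i) <= M >].

Record bounded_family := BoundedFamily {
  bounded_family_fun :> I -> Z;
  bounded_family_subproof : bounded_family_fun \in is_bounded }.

HB.instance Definition _ := [isSub for bounded_family_fun].
HB.instance Definition _ := [Choice of bounded_family by <:].

Lemma is_bounded_submod : submod_closed is_bounded.
Proof.
split=> [|a f g /asboolP[M Mf] /asboolP[N Ng]].
  by apply/asboolP; exists 0 => i; rewrite nrm0.
apply/asboolP; exists (nrm (a : K^o) * M + N) => i; rewrite !fctE.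
by rewrite (le_trans (nrmD _ _))// lerD// nrmZ ler_wpM2l// nrm_ge0.
Qed.

HB.instance Definition _ :=
  GRing.isSubmodClosed.Build K (I -> Z) is_bounded is_bounded_submod.
HB.instance Definition _ := [SubChoice_isSubLmodule of bounded_family by <:].

Definition ultra_norm (z : bounded_family) : R := lim (nrm (z i) @[i --> U]).

Lemma ultra_norm_cvg (z : bounded_family) :
  nrm (z i) @[i --> U] --> ultra_norm z.
Proof.
case: z => z zP; have /asboolP[M zM] := zP.
have FF : ProperFilter (nrm (z i) @[i --> U]) by apply: fmap_proper_filter.
have [|l [_ cl]] := @segment_compact R 0 M (nrm (z i) @[i --> U]) FF.
  by apply: nearW => i /=; rewrite in_itv /= nrm_ge0 zM.
apply/cvg_ex; exists l => A Al.
have [//|nA] := in_ultra_setVsetC ((fun i => nrm (z i)) @^-1` A) hU.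
by have [r [nAr Ar]] := cl (~` A) A nA Al.
Qed.

Arguments ultra_norm_cvg : clear implicits.

Lemma ultra_normD (y z : bounded_family) :
  ultra_norm (y + z) <= ultra_norm y + ultra_norm z.
Proof.
pose d i := nrm (y i) + nrm (z i) - nrm (y i + z i).
have dc : d i @[i --> U] --> ultra_norm y + ultra_norm z - ultra_norm (y + z).
  apply: cvgB (ultra_norm_cvg (y + z)).
  by apply: cvgD; exact: ultra_norm_cvg.
rewrite -subr_ge0 -(cvg_lim _ dc)//; apply: limr_ge; first exact: cvgP dc.
by apply: nearW => i; rewrite subr_ge0 nrmD.
Qed.

Lemma ultra_normZ (a : K) (z : bounded_family) :
  ultra_norm (a *: z) = nrm (a : K^o) * ultra_norm z.
Proof.
apply/cvg_lim => //.
rewrite (_ : (fun i => _) = fun i => nrm (a : K^o) * nrm (z i)).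
  exact: cvgMl_tmp (ultra_norm_cvg z).
by apply/funext => i; exact: nrmZ.
Qed.

Definition ultra_seminorm := Seminorm ultra_normD ultra_normZ.

(* Bounded families modulo those whose norm tends to 0 along [U]. *)
Definition ultrapower : normedModType K := sep ultra_seminorm.

End Ultrapower.

Section Squares.
Variables (R : realType) (k : scalar_kind).
Local Notation K := (scalar_field R k).

(* The quotients are bounded by 2, so this is a genuine supremum as soon as [V]
   is nonzero; for [V = 0] the set is empty and the value is 0. *)
Definition C_NJ (V : normedModType K) : R :=
  sup [set r | exists x y : V, (x, y) <> (0, 0) /\
    r = (nrm (x + y) ^+ 2 + nrm (x - y) ^+ 2) /
        (2 * (nrm x ^+ 2 + nrm y ^+ 2))].

Definition finite_dim (V : lmodType K) : Prop :=
  exists (n : nat) (e : 'I_n -> V),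
    forall v, exists c : 'I_n -> K, v = \sum_(i < n) c i *: e i.

Definition Sq (E Z : normedModType K) : Prop :=
  exists A B : nat -> bounded_op E Z,
    [/\ forall n, nrm (A n) = 1, forall n, nrm (B n) = 1,
        nrm (A n + B n) @[n --> \oo] --> (2 : R) &
        nrm (A n - B n) @[n --> \oo] --> (2 : R)].

Definition ultra_Sq (E Z : normedModType K) : Prop :=
  exists (I : Type) (U : set_system I) (hU : UltraFilter U)
         (A B : bounded_op E (ultrapower hU Z)),
    [/\ nrm A = 1, nrm B = 1, nrm (A + B) = 2 & nrm (A - B) = 2].

End Squares.

(* Main.v *)
From HB Require Import structures.
Require Import Defs.
From mathcomp Require Import all_boot all_order all_algebra.
From mathcomp Require Import complex lra.
From mathcomp Require Import interval_inference boolp classical_sets functions.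
From mathcomp Require Import reals topology normedtype.

(** All four equivalences go through one notion.  A seminorm [p] has near squares
    ([near_square]) when for each [e > 0] there are [x] and [y] with [p x] and
    [p y] at most [1 + e], and [p (x + y)] and [p (x - y)] at least [2 - e].

    A normed space [V] has near squares exactly when [C_NJ V = 2]
    ([C_NJ_near_square]): the quotient that defines [C_NJ] can approach [2] only
    if the two vectors have almost equal norms and both [x + y] and [x - y] almost
    attain the bound of the triangle inequality.  For spaces of operators,
    normalising shows that near squares are what [Sq] asserts
    ([Sq_near_square]).  Near squares are not affected by completion
    ([near_square_completion]), so the two tensor norms may be studied on the
    algebraic tensor product.

    For the injective norm, [\sum x_j (x) y_j |-> (g |-> \sum g y_j *: x_j)] is an
    isometry from the tensor product to the operators from the dual of [Y] to [X],
    by the Hahn-Banach theorem in [X], and it is onto because [Y] has finite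
    dimension ([near_square_inj]).

    For the projective norm, the dual of the tensor product is the space of
    operators from [Y] to the dual of [X], and having near squares is a self-dual
    property ([near_square_dual]): if [f] norms [x + y] and [g] norms [x - y], then
    [x] and [y] almost norm [f + g] and [f - g].  Applied in both directions this
    gives [near_square_proj].

    For ultrapowers, the operators from a finite-dimensional space [E] into an
    ultrapower of [Z] are exactly the ultraproducts of bounded families of
    operators from [E] to [Z] ([bounded_induces], [frame_lift]), and by compactness
    of the unit ball of [E] the norm of an ultraproduct is the limit of the norms
    ([induces_nrm]).  Exact squares in the ultrapower thus correspond to
    sequences of near squares.

    Two tools support this.  The Hahn-Banach theorem for a seminorm over the
    real or complex field ([hahn_banach]) is obtained from minimal sublinear
    functionals.  Finite dimension is used only through frames: finite families
    of bounded functionals [u.1] and vectors [u.2] with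
    [x = \sum u.1 x *: u.2] for all [x] ([finite_dim_frame]). *)

Set Implicit Arguments.
Unset Strict Implicit.
Unset Printing Implicit Defensive.

Import Order.TTheory GRing.Theory Num.Theory.
Import numFieldNormedType.Exports.

Local Open Scope classical_set_scope.
Local Open Scope ring_scope.

(** * The Hahn-Banach theorem for seminorms, over both scalar fields *)

Section Scalars.
Variables (R : realType) (k : scalar_kind).
Local Notation K := (scalar_field R k).

Lemma of_realN x : of_real k (- x) = - of_real k x :> K.
Proof. by apply/eqP; rewrite -addr_eq0 -of_realD addNr of_real0. Qed.

Lemma reN (x : K) : re (- x) = - re x.
Proof. by apply/eqP; rewrite -addr_eq0 -reD addNr re0. Qed.

Lemma re_le_nrm (x : K) : re x <= nrm (x : K^o).
Proof.
rewrite /nrm; move: x; rewrite /re; case: k => /= [x|z]; first exact: ler_norm.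
change (complex.Re z <= complex.Re `|z : R[i]%C|); rewrite normc_def.
case: z => a b /=.
by rewrite (le_trans (ler_norm a))// -sqrtr_sqr ler_wsqrtr// lerDl sqr_ge0.
Qed.

(** Rotating a scalar onto the nonnegative half-line turns a bound on real
    parts into a bound on moduli, for real and complex scalars alike. *)
Lemma phase (z : K) : exists2 a : K, nrm (a : K^o) = 1 & re (a * z) = nrm (z : K^o).
Proof.
have n1 : nrm (1 : K^o) = 1 by rewrite /nrm normr1 -(of_real1 R k) of_realK.
have [->|z0] := eqVneq z 0.
  by exists 1; rewrite // mulr0 re0 nrm0.
exists (`|z| / z); last by rewrite mulfVK.
apply: (@of_real_inj R k); rewrite of_real_nrm of_real1 normf_div normr_id.
by rewrite divff // normr_eq0.
Qed.

End Scalars.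

Section HahnBanach.
Variables (R : realType) (k : scalar_kind).
Local Notation K := (scalar_field R k).
Variable V : lmodType K.
Implicit Types (p q f : V -> R) (x y : V).

Definition sublinear p :=
  (forall x y, p (x + y) <= p x + p y) /\
  (forall (c : R) x, 0 <= c -> p (of_real k c *: x) = c * p x).

Lemma sublinear0 p : sublinear p -> p 0 = 0.
Proof. by move=> [_ /(_ 0 0)]; rewrite scaler0 mul0r; apply. Qed.

Lemma sublinear_opp p x : sublinear p -> - p (- x) <= p x.
Proof.
move=> sp; have := sp.1 x (- x).
by rewrite subrr sublinear0//; lra.
Qed.

(** For positive [c], applying the inequality to [c^-1] gives the converse one. *)
Lemma sublinear_homog p : p 0 = 0 ->
  (forall (c : R) x, 0 < c -> p (of_real k c *: x) <= c * p x) ->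
  forall (c : R) x, 0 <= c -> p (of_real k c *: x) = c * p x.
Proof.
move=> p0 ph c x; rewrite le_eqVlt => /predU1P[<-|c0].
  by rewrite of_real0 scale0r p0 mul0r.
apply/eqP; rewrite eq_le ph//= mulrC -ler_pdivlMr// mulrC.
rewrite -{1}(scale1r x) -(of_real1 R k) -(mulVf (lt0r_neq0 c0)) of_realM -scalerA.
by rewrite ph// invr_gt0.
Qed.

(** The witness [q x = inf (p (x + t y) - t * p y)], over [t >= 0], is the largest
    sublinear functional below [p] whose value at [- y] is at most [- p y].  A
    minimal [p] coincides with it, which forces [p (- y) = - p y]; this is what
    makes minimal sublinear functionals linear. *)
Lemma sublinear_shrink p y : sublinear p ->
  exists q, [/\ sublinear q, forall x, q x <= p x & q (- y) <= - p y].
Proof.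
move=> sp; have [pD pZ] := sp.
pose S x := [set p (x + of_real k t *: y) - t * p y | t in [set t | 0 <= t]].
pose q x := inf (S x).
have Sinf x : has_inf (S x).
  split; first by exists (p (x + of_real k 0 *: y) - 0 * p y), 0 => //=.
  exists (- p (- x)) => _ [t /= t0 <-].
  have := pD (x + of_real k t *: y) (- x).
  rewrite addrAC subrr add0r pZ//; lra.
have q_le x (t : R) : 0 <= t -> q x <= p (x + of_real k t *: y) - t * p y.
  by move=> t0; apply: ge_inf; [exact: (Sinf x).2|exists t].
have le_q x (m : R) :
    (forall t : R, 0 <= t -> m <= p (x + of_real k t *: y) - t * p y) -> m <= q x.
  move=> H; apply: lb_le_inf; first exact: (Sinf x).1.
  by move=> _ [t /= t0 <-]; exact: H.
have qp x : q x <= p x.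
  by have := q_le x 0 (lexx 0); rewrite of_real0 scale0r addr0 mul0r subr0.
exists q; split => //; last first.
  have := q_le (- y) 1 ler01.
  by rewrite of_real1 scale1r addNr mul1r sublinear0// sub0r.
split=> [x z|].
  rewrite -lerBlDr; apply: (le_q) => s s0; rewrite lerBlDr -lerBlDl.
  apply: (le_q) => t t0; rewrite lerBlDl.
  apply: (le_trans (q_le _ _ (addr_ge0 s0 t0))).
  rewrite of_realD scalerDl addrACA mulrDl.
  have := pD (x + of_real k s *: y) (z + of_real k t *: y); lra.
apply: sublinear_homog.
  apply/eqP; rewrite eq_le -{1}(sublinear0 sp) qp /=.
  by apply: (le_q) => t t0; rewrite add0r pZ// subrr.
move=> c x c0; rewrite mulrC -ler_pdivrMr//; apply: (le_q) => t t0.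
rewrite ler_pdivrMr// (le_trans (q_le _ (c * t) _))//.
  by rewrite mulr_ge0// ltW.
rewrite of_realM -scalerA -scalerDr (pZ _ _ (ltW c0)); lra.
Qed.

(** Zorn's lemma for the reverse pointwise order.  The infimum of a chain is
    finite because [- p (- x) <= - q (- x) <= q x] for each sublinear [q] below
    [p]. *)
Lemma minimal_sublinear p : sublinear p ->
  exists f, [/\ sublinear f, forall x, f x <= p x &
    forall q, sublinear q -> (forall x, q x <= f x) -> q = f].
Proof.
move=> sp; pose T := {q : V -> R | sublinear q /\ forall x, q x <= p x}.
pose le_T (s t : T) := `[< forall x, sval t x <= sval s x >].
have [|||A Atot|[f [sf fp]] fmin] := @Zorn T le_T.
- by move=> t; apply/asboolP.
- move=> r s t /asboolP rs /asboolP st; apply/asboolP => x.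
  exact: le_trans (st x) (rs x).
- move=> [s Ps] [t Pt] /asboolP /= st /asboolP /= ts; apply: eq_exist.
  by apply/funext => x; apply/le_anti; rewrite st ts.
- have [[t0 At0]|A0] := pselect (A !=set0); last first.
    exists (exist _ p (conj sp (fun=> lexx _))) => s As.
    by case: A0; exists s.
  pose S x := [set sval t x | t in A].
  have Sinf x : has_inf (S x).
    split; first by exists (sval t0 x), t0.
    exists (- p (- x)) => _ [[t [st tp]] /= At <-].
    by rewrite (le_trans _ (sublinear_opp x st))// lerN2.
  pose q x := inf (S x).
  have q_le x t : A t -> q x <= sval t x.
    by move=> At; apply: ge_inf; [exact: (Sinf x).2|exists t].
  have le_q x (m : R) : (forall t, A t -> m <= sval t x) -> m <= q x.
    move=> H; apply: lb_le_inf; first exact: (Sinf x).1.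
    by move=> _ [t /= t1 <-]; exact: H.
  suff sq : sublinear q.
    have qp x : q x <= p x := le_trans (q_le x t0 At0) ((svalP t0).2 x).
    by exists (exist _ q (conj sq qp)) => s As; apply/asboolP => x /=; exact: q_le.
  split=> [x y|].
    rewrite -lerBlDr; apply: (le_q) => s As; rewrite lerBlDr -lerBlDl.
    apply: (le_q) => t At; rewrite lerBlDl.
    have [/asboolP st|/asboolP ts] := Atot _ _ As At.
      apply: (le_trans (q_le _ _ At)).
      by rewrite (le_trans ((svalP t).1.1 _ _))// lerD2r st.
    apply: (le_trans (q_le _ _ As)).
    by rewrite (le_trans ((svalP s).1.1 _ _))// lerD2l ts.
  apply: sublinear_homog.
    apply/eqP; rewrite eq_le; apply/andP; split.
      by rewrite (le_trans (q_le _ _ At0))// sublinear0//; exact: (svalP t0).1.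
    by apply: (le_q) => t At; rewrite sublinear0//; exact: (svalP t).1.
  move=> c x c0; rewrite mulrC -ler_pdivrMr//; apply: (le_q) => t At.
  rewrite ler_pdivrMr// (le_trans (q_le _ t _))//.
  by rewrite ((svalP t).1.2 _ _ (ltW c0)) mulrC.
- exists f; split => // q sq qf.
  have qp x : q x <= p x := le_trans (qf x) (fp x).
  have /fmin : le_T (exist _ f (conj sf fp)) (exist _ q (conj sq qp)).
    exact/asboolP.
  by case.
Qed.

(** Minimality identifies [f] with its shrinkings, which makes it odd; an odd
    subadditive function is additive. *)
Lemma minimal_sublinear_linear f : sublinear f ->
  (forall q, sublinear q -> (forall x, q x <= f x) -> q = f) ->
  (forall x y, f (x + y) = f x + f y) /\
  (forall (c : R) x, f (of_real k c *: x) = c * f x).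
Proof.
move=> sf fmin.
have fN y : f (- y) = - f y.
  have [q [sq qf qy]] := sublinear_shrink y sf.
  move: qy; rewrite (fmin q sq qf) => qy; apply/le_anti; rewrite qy /=.
  by rewrite lerNl sublinear_opp.
split=> [x y|c x].
  apply/le_anti; rewrite sf.1 /= -lerBrDr -fN.
  by have := sf.1 (x + y) (- y); rewrite addrK.
have [c0|/ltW c0] := leP 0 c; first exact: sf.2.
have : f (of_real k (- c) *: x) = - c * f x by rewrite sf.2// oppr_ge0.
by rewrite of_realN scaleNr fN mulNr => /oppr_inj.
Qed.

(** Shrinking [p] along [y] before minimising fixes the value at [y]: the result
    satisfies [f (- y) <= - p y]. *)
Lemma real_hahn_banach p y : sublinear p -> exists f,
  [/\ forall x z, f (x + z) = f x + f z,
      forall (c : R) x, f (of_real k c *: x) = c * f x,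
      forall x, f x <= p x & f y = p y].
Proof.
move=> sp; have [q [sq qp qy]] := sublinear_shrink y sp.
have [f [sf fq fmin]] := minimal_sublinear sq.
have [fD fZ] := minimal_sublinear_linear sf fmin.
have fp x : f x <= p x := le_trans (fq x) (qp x).
exists f; split => //; apply/le_anti; rewrite fp /=.
have := le_trans (fq (- y)) qy.
by rewrite -scaleN1r -(of_real1 R k) -of_realN fZ mulN1r lerN2.
Qed.

End HahnBanach.

(** A real-linear [u] is the real part of one scalar-linear functional: [u]
    itself over the reals, [u x - i u (i x)] over the complex numbers. *)
Lemma re_lift (R : realType) (k : scalar_kind)
    (V : lmodType (scalar_field R k)) (u : V -> R) :
  (forall x y, u (x + y) = u x + u y) ->
  (forall (c : R) x, u (of_real k c *: x) = c * u x) ->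
  exists f : {linear V -> (scalar_field R k)^o}, forall x, re (f x) = u x.
Proof.
case: k V u => /= V u uD uZ.
  have lu : linear (u : V -> R^o) by move=> a x y; rewrite uD uZ.
  pose Hf := GRing.isLinear.Build R V R^o *:%R u lu.
  pose f : {linear V -> R^o} := HB.pack u Hf.
  by exists f.
pose g x : (R[i]%C)^o := (u x +i* - u ('i%C *: x))%C.
have lg : linear g.
  move=> [a b] x y.
  have E : ((a +i* b)%C *: x = a%:C%C *: x + b%:C%C *: ('i%C *: x)).
    rewrite scalerA -scalerDl; congr (_ *: _); apply/eqP.
    by rewrite eq_complex /= !(mul0r,mulr0,mulr1,subr0,addr0,add0r) !eqxx.
  have E2 : 'i%C *: ((a +i* b)%C *: x) = a%:C%C *: ('i%C *: x) - b%:C%C *: x.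
    rewrite !scalerA -scalerBl; congr (_ *: _); apply/eqP.
    rewrite eq_complex /= !(mul0r,mulr0,mulr1,mul1r,subr0,addr0,add0r,oppr0).
    by rewrite !eqxx.
  have uN z : u (- z) = - u z.
    have u0 : u 0 = 0 by have := uZ 0 0; rewrite scaler0 mul0r.
    by apply/eqP; rewrite -addr_eq0 -uD addNr u0.
  rewrite /g scalerDr E2 {1}E !uD uN.
  have uZ' (c : R) z : u (c%:C%C *: z) = c * u z := uZ c z.
  rewrite !uZ'; apply/eqP; rewrite eq_complex /=.
  by apply/andP; split; apply/eqP; lra.
pose Hf := GRing.isLinear.Build _ V (R[i]%C)^o *:%R g lg.
pose f : {linear V -> (R[i]%C)^o} := HB.pack g Hf.
by exists f.
Qed.

Theorem hahn_banach (R : realType) (k : scalar_kind)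
    (V : lmodType (scalar_field R k)) (p : seminorm V) (y : V) :
  exists f : {linear V -> (scalar_field R k)^o},
    (forall x, nrm (f x) <= p x) /\ re (f y) = p y.
Proof.
have sp : sublinear p.
  split; first exact: seminormD.
  by move=> c x c0; rewrite seminormZ nrm_of_real ger0_norm.
have [u [uD uZ up uy]] := real_hahn_banach y sp.
have [f fu] := re_lift uD uZ; exists f; split; last by rewrite fu.
move=> x; have [a a1 <-] := phase (f x).
have -> : a * f x = f (a *: x) by rewrite linearZ.
by rewrite fu (le_trans (up _))// seminormZ a1 mul1r.
Qed.

(** * Near squares *)

Section NearSquare.
Variable R : realType.

(** Approximate squares, in the form that every construction below respects:
    bounds of [1 + e] on [x] and [y], rather than equalities, survive small
    perturbations and need no normalisation. *)
Definition near_square (V : zmodType) (p : V -> R) := forall e : R, 0 < e ->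
  exists x y, [/\ p x <= 1 + e, p y <= 1 + e,
    2 - e <= p (x + y) & 2 - e <= p (x - y)].

Lemma near_square_small (V : zmodType) (p : V -> R) (d : R) : 0 < d ->
  (forall e : R, 0 < e -> e <= d ->
    exists x y, [/\ p x <= 1 + e, p y <= 1 + e,
      2 - e <= p (x + y) & 2 - e <= p (x - y)]) ->
  near_square p.
Proof.
move=> d0 H e e0.
have [||x [y [px py pD pB]]] := H (Num.min e d).
- by rewrite lt_min e0.
- by rewrite ge_min lexx orbT.
have m : Num.min e d <= e by rewrite ge_min lexx.
by exists x, y; split; lra.
Qed.

(** How near squares travel from [p] to [q]: it is enough to imitate each pair
    [x, y] up to an arbitrarily small error, without any map from [V] to [W]. *)
Lemma near_square_approx (V W : zmodType) (p : V -> R) (q : W -> R) :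
  (forall (e : R) x y, 0 < e -> exists x' y',
    [/\ q x' <= p x + e, q y' <= p y + e,
        p (x + y) <= q (x' + y') + e & p (x - y) <= q (x' - y') + e]) ->
  near_square p -> near_square q.
Proof.
move=> H sp e e0; have e20 : 0 < e / 2 by rewrite divr_gt0.
have [x [y [px py pD pB]]] := sp _ e20.
have [x' [y' [qx qy qD qB]]] := H _ x y e20.
by exists x', y'; split; lra.
Qed.

(** Near squares are self-dual.  If [f] almost norms [x + y] and [g] almost norms
    [x - y], then [f x], [f y], [g x] are almost [1] and [g y] is almost [-1], so
    that [x] and [y] witness that [f + g] and [f - g] have norm almost [2].
    Exchanging the two sides of a pairing that norms both gives the equivalence. *)
Lemma near_square_dual (V W : zmodType) (p : V -> R) (q : W -> R)
    (b : V -> W -> R) :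
  (forall v w w', b v (w + w') = b v w + b v w') ->
  (forall v w w', b v (w - w') = b v w - b v w') ->
  (forall v v' w, b (v + v') w = b v w + b v' w) ->
  (forall v v' w, b (v - v') w = b v w - b v' w) ->
  (forall v, 0 <= p v) -> (forall w, 0 <= q w) ->
  (forall v w, `|b v w| <= p v * q w) ->
  (forall v e, 0 < e -> exists2 w, q w <= 1 & p v - e <= b v w) ->
  near_square p -> near_square q.
Proof.
move=> bDr bBr bDl bBl p0 q0 bpq normb sp.
apply: (near_square_small ltr01) => e e0 e1.
(* chosen so that [(2 - 6 * c) / (1 + c) >= 2 - e] *)
pose c := e / 8.
have c0 : 0 < c by rewrite divr_gt0.
have ec : e = 8 * c by rewrite /c; lra.
have [x [y [px py pD pB]]] := sp c c0.
have [f f1 fD] := normb (x + y) c c0.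
have [g g1 gB] := normb (x - y) c c0.
have le1c v w : p v <= 1 + c -> q w <= 1 -> - (1 + c) <= b v w <= 1 + c.
  move=> pv qw; rewrite -ler_norml (le_trans (bpq v w))//.
  by rewrite -[leRHS]mulr1 ler_pM.
have /andP[_ xf] := le1c x f px f1.
have /andP[_ yf] := le1c y f py f1.
have /andP[_ xg] := le1c x g px g1.
have /andP[yg _] := le1c y g py g1.
move: fD gB; rewrite bDl bBl => fD gB.
have le_q v w : p v <= 1 + c -> 2 - 6 * c <= b v w -> 2 - e <= q w.
  move=> pv bw; have c10 : 0 < 1 + c by lra.
  rewrite -(ler_pM2r c10) ec; apply: (@le_trans _ _ (2 - 6 * c)).
    by have := sqr_ge0 c; lra.
  rewrite (le_trans bw)// (le_trans (ler_norm _))// (le_trans (bpq v w))//.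
  by rewrite mulrC ler_wpM2l.
exists f, g; split.
- by rewrite (le_trans f1)// lerDl ltW.
- by rewrite (le_trans g1)// lerDl ltW.
- by apply: (le_q x); rewrite // bDr; lra.
- by apply: (le_q y); rewrite // bBr; lra.
Qed.

End NearSquare.

Section NormedSquares.
Variables (R : realType) (k : scalar_kind).
Local Notation K := (scalar_field R k).
Implicit Types V : normedModType K.

Lemma nrm_gt0 V (x : V) : x != 0 -> 0 < nrm x.
Proof.
move=> x0; rewrite lt_neqAle nrm_ge0 andbT eq_sym.
by apply: contra_neq x0 => /nrm_eq0.
Qed.

Lemma nrmB V (x y : V) : nrm (x - y) <= nrm x + nrm y.
Proof. by rewrite -(nrmN y) nrmD. Qed.

Lemma nrm_real_scale V (c : R) (x : V) : 0 <= c ->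
  nrm (of_real k c *: x) = c * nrm x.
Proof. by move=> c0; rewrite nrmZ nrm_of_real ger0_norm. Qed.

Definition NJ_ratio V (x y : V) : R :=
  (nrm (x + y) ^+ 2 + nrm (x - y) ^+ 2) / (2 * (nrm x ^+ 2 + nrm y ^+ 2)).

Lemma NJ_denom_gt0 V (x y : V) : (x, y) <> (0, 0) ->
  0 < nrm x ^+ 2 + nrm y ^+ 2.
Proof.
move=> xy; rewrite lt_neqAle addr_ge0 ?sqr_ge0// andbT eq_sym.
rewrite paddr_eq0 ?sqr_ge0// !sqrf_eq0; apply/negP => /andP[/eqP x0 /eqP y0].
by apply: xy; rewrite (nrm_eq0 x0) (nrm_eq0 y0).
Qed.

Lemma NJ_ratio_le2 V (x y : V) : (x, y) <> (0, 0) -> NJ_ratio x y <= 2.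
Proof.
move=> xy; have n0 := NJ_denom_gt0 xy.
rewrite ler_pdivrMr ?mulr_gt0//.
have D : nrm (x + y) ^+ 2 <= (nrm x + nrm y) ^+ 2.
  by rewrite ler_sqr ?nnegrE ?addr_ge0 ?nrm_ge0 ?nrmD.
have B : nrm (x - y) ^+ 2 <= (nrm x + nrm y) ^+ 2.
  by rewrite ler_sqr ?nnegrE ?addr_ge0 ?nrm_ge0 ?nrmB.
have := sqr_ge0 (nrm x - nrm y); lra.
Qed.

Lemma C_NJ_eq2P V : C_NJ V = 2 <->
  forall d : R, 0 < d -> exists x y : V, (x, y) <> (0, 0) /\ 2 - d < NJ_ratio x y.
Proof.
rewrite /C_NJ; set S := [set r | _].
have ubS : ubound S 2 by move=> _ [x [y [xy ->]]]; exact: NJ_ratio_le2.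
split=> [S2 d d0|H].
  have S0 : S !=set0.
    have [//|/nonemptyPn S0] := pselect (S !=set0).
    by move: S2; rewrite S0 sup0 => /eqP; rewrite eq_sym pnatr_eq0.
  have [_ [x [y [xy ->]]]] := sup_adherent d0 (conj S0 (ex_intro _ 2 ubS)).
  by rewrite S2; exists x, y.
have [x0 [y0 [xy0 _]]] := H 1 ltr01.
have S0 : S !=set0 by exists (NJ_ratio x0 y0), x0, y0.
apply/le_anti; rewrite ge_sup//=; apply/ler_addgt0Pr => d d0.
have [x [y [xy r]]] := H d d0; rewrite -lerBlDr (le_trans (ltW r))//.
by apply: ub_le_sup; [exists 2|exists x, y].
Qed.

Lemma NJ_ratioC V (x y : V) : NJ_ratio x y = NJ_ratio y x.
Proof. by rewrite /NJ_ratio (addrC x) -(opprB x y) nrmN (addrC (nrm x ^+ 2)). Qed.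

Lemma NJ_ratioZ V (c : R) (x y : V) : c != 0 ->
  NJ_ratio (of_real k c *: x) (of_real k c *: y) = NJ_ratio x y.
Proof.
move=> c0; rewrite /NJ_ratio -scalerDr -scalerBr !nrmZ nrm_of_real !exprMn.
rewrite -!mulrDr mulrCA -mulf_div divff ?mul1r//.
by rewrite sqrf_eq0 normr_eq0.
Qed.

(** The quantitative core of [C_NJ_near_square], for [x] of norm [1] and [y] of
    norm [b <= 1], with [s] and [d] the norms of [x + y] and [x - y].  Since both
    are at most [1 + b], a ratio close to [2] forces [(1 + b) ^+ 2] close to
    [2 * (1 + b ^+ 2)], hence [b] close to [1], and then [s] close to [2].  The
    deviation [e ^+ 2 / 32] is what bounds [1 - b] by [e / 4]. *)
Lemma NJ_ratio_square (e b s d : R) : 0 < e -> e <= 1 -> 0 <= b -> b <= 1 ->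
  0 <= s -> 0 <= d -> s <= 1 + b -> d <= 1 + b ->
  (2 - e ^+ 2 / 32) * (2 * (1 + b ^+ 2)) < s ^+ 2 + d ^+ 2 -> 2 - e <= s.
Proof.
move=> e0 e1 b0 b1 s0 d0 sb db H.
have d2 : d ^+ 2 <= (1 + b) ^+ 2 by nra.
have s2 : s ^+ 2 <= (1 + b) ^+ 2 by nra.
have b2 : b ^+ 2 <= 1 by nra.
have t2 : (1 - b) ^+ 2 <= e ^+ 2 / 16 by nra.
have t : 1 - b <= e / 4 by nra.
rewrite leNgt; apply/negP => se.
have : s ^+ 2 < (2 - e) ^+ 2 by nra.
nra.
Qed.

(** From ratios close to [2] to near squares, the pair is scaled so that its
    longer vector has norm [1]. *)
Lemma C_NJ_near_square V : C_NJ V = 2 <-> near_square (@nrm R k V).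
Proof.
split=> [/C_NJ_eq2P H|H].
  apply: (near_square_small ltr01) => e e0 e1.
  have d0 : 0 < e ^+ 2 / 32 by rewrite divr_gt0 ?exprn_gt0.
  have [x [y [yx xy r]]] : exists x y : V,
      [/\ nrm y <= nrm x, (x, y) <> (0, 0) & 2 - e ^+ 2 / 32 < NJ_ratio x y].
    have [x [y [xy r]]] := H _ d0.
    have [yx|/ltW yx] := leP (nrm y) (nrm x); first by exists x, y.
    exists y, x; split; rewrite // 1?NJ_ratioC//.
    by move=> [y0 x0]; apply: xy; rewrite y0 x0.
  have x0 : 0 < nrm x.
    apply: nrm_gt0; apply/eqP => x0; apply: xy; rewrite x0; congr (_, _).
    by apply: nrm_eq0; apply/le_anti; rewrite nrm_ge0 andbT -(nrm0 V) -{1}x0.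
  have c0 : (nrm x)^-1 != 0 by rewrite invr_eq0 lt0r_neq0.
  pose u := of_real k (nrm x)^-1 *: x; pose v := of_real k (nrm x)^-1 *: y.
  have nu : nrm u = 1.
    by rewrite nrm_real_scale ?invr_ge0 ?nrm_ge0// mulVf ?lt0r_neq0.
  have nv : nrm v <= 1.
    rewrite nrm_real_scale ?invr_ge0 ?nrm_ge0// mulrC ler_pdivrMr//.
    by rewrite mul1r.
  have {r} : 2 - e ^+ 2 / 32 < NJ_ratio u v by rewrite NJ_ratioZ.
  rewrite /NJ_ratio nu expr1n ltr_pdivlMr => [r|]; last first.
    by rewrite mulr_gt0// ltr_wpDr ?sqr_ge0.
  have D := nrmD u v; have B := nrmB u v; rewrite nu in D B.
  exists u, v; split; rewrite ?nu.
  - lra.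
  - lra.
  - by apply: (NJ_ratio_square _ _ _ _ _ _ D B r); rewrite // nrm_ge0.
  - by rewrite [X in _ < X]addrC in r; apply: (NJ_ratio_square _ _ _ _ _ _ B D r);
      rewrite // nrm_ge0.
apply/C_NJ_eq2P => d d0.
(* for a near square with tolerance [e] the ratio is at least
   [(2 - e) ^+ 2 / (2 * (1 + e) ^+ 2) >= 2 - 6 * e >= 2 - d / 2] *)
pose e := Num.min (d / 12) (1/4).
have e0 : 0 < e by rewrite lt_min; apply/andP; split; lra.
have ed : e <= d / 12 by rewrite ge_min lexx.
have e4 : e <= 1/4 by rewrite ge_min lexx orbT.
have [x [y [xe ye De Be]]] := H e e0.
have xy : (x, y) <> (0, 0).
  by move=> [x0 y0]; move: De; rewrite x0 y0 addr0 nrm0; lra.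
exists x, y; split => //; have n0 := NJ_denom_gt0 xy.
rewrite ltr_pdivlMr ?mulr_gt0//.
have nx := nrm_ge0 x; have ny := nrm_ge0 y.
have x2 : nrm x ^+ 2 <= (1 + e) ^+ 2 by nra.
have y2 : nrm y ^+ 2 <= (1 + e) ^+ 2 by nra.
have D2 : (2 - e) ^+ 2 <= nrm (x + y) ^+ 2 by nra.
have B2 : (2 - e) ^+ 2 <= nrm (x - y) ^+ 2 by nra.
have [d2|d2] := leP 2 d; last by nra.
apply: (@le_lt_trans _ _ 0); first by rewrite mulr_le0_ge0//; nra.
nra.
Qed.

(** If two norms are at most [1 + d] and the norm of the sum is at least [2 - d],
    then both norms are at least [1 - 2 * d], so that dividing the vectors by
    their norms moves each by at most [2 * d]. *)
Lemma near_square_unit V (e : R) : 0 < e -> near_square (@nrm R k V) ->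
  exists x y : V,
    [/\ nrm x = 1, nrm y = 1, 2 - e <= nrm (x + y) & 2 - e <= nrm (x - y)].
Proof.
(* the two normalisations cost [4 * d], on top of the tolerance [d] *)
move=> e0 H; pose d := Num.min (e / 5) (1/5).
have d0 : 0 < d by rewrite lt_min; apply/andP; split; lra.
have de : d <= e / 5 by rewrite ge_min lexx.
have d5 : d <= 1/5 by rewrite ge_min lexx orbT.
have [x [y [xd yd D B]]] := H d d0.
have Dxy := nrmD x y.
have unit (z : V) : nrm z <= 1 + d -> 1 - 2 * d <= nrm z ->
    exists2 u, nrm u = 1 & nrm (z - u) <= 2 * d.
  move=> z1 z2; have z0 : 0 < nrm z by lra.
  exists (of_real k (nrm z)^-1 *: z).
    by rewrite nrm_real_scale ?invr_ge0 ?nrm_ge0// mulVf ?lt0r_neq0.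
  rewrite -{1}(scale1r z) -(of_real1 R k) -scaleNr -of_realN -scalerDl -of_realD.
  rewrite nrmZ nrm_of_real -[X in _ * X]gtr0_norm// -normrM mulrBl mul1r.
  rewrite mulVf ?lt0r_neq0// ler_norml; lra.
have [||u u1 xu] := unit x; [lra|lra|].
have [||v v1 yv] := unit y; [lra|lra|].
exists u, v; split => //.
  have -> : u + v = (x + y) - ((x - u) + (y - v)).
    by rewrite opprD !opprB addrACA (addrC x) (addrC y) !subrK.
  have := nrmD (x - u) (y - v).
  have := nrmB (x + y - ((x - u) + (y - v))) (- ((x - u) + (y - v))).
  rewrite opprK subrK nrmN; lra.
have -> : u - v = (x - y) - ((x - u) - (y - v)).
  by rewrite -{1}(subKr x u) -{1}(subKr y v) (opprD y) addrACA -opprD.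
have := nrmB (x - u) (y - v).
have := nrmB (x - y - ((x - u) - (y - v))) (- ((x - u) - (y - v))).
rewrite opprK subrK nrmN; lra.
Qed.

Lemma Sq_near_square (E Z : normedModType K) :
  Sq E Z <-> near_square (@nrm R k (bounded_op E Z)).
Proof.
split=> [[A [B [A1 B1 D2 B2]]] e e0|H].
  have le_near (u : nat -> R) : u n @[n --> \oo] --> (2 : R) ->
      \forall n \near \oo, 2 - e <= u n.
    by move=> /cvgrPdist_le/(_ e e0); apply: filterS => n /=; rewrite ler_norml; lra.
  have [n [Dn Bn]] := filter_ex (filterI (le_near _ D2) (le_near _ B2)).
  by exists (A n), (B n); split; rewrite ?A1 ?B1 ?lerDl// ltW.
have inv0 n : (0 : R) < n.+1%:R^-1 by rewrite invr_gt0.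
have [A HA] := choice (fun n : nat => near_square_unit (inv0 n) H).
have [B HB] := choice HA.
have cvg2 (C : nat -> bounded_op E Z) : (forall n, nrm (C n) <= 2) ->
    (forall n, 2 - n.+1%:R^-1 <= nrm (C n)) -> nrm (C n) @[n --> \oo] --> (2 : R).
  move=> C2 Cn; apply/cvgrPdist_le => e e0.
  have [N _ HN] := near_infty_natSinv_lt (PosNum e0).
  exists N => // n Nn; have ne : n.+1%:R^-1 < e := HN n Nn.
  have Ce : 2 - e <= nrm (C n) by rewrite (le_trans _ (Cn n))// lerD2l lerN2 ltW.
  by have := C2 n; rewrite /= ger0_norm ?subr_ge0//; lra.
exists A, B; split.
- by move=> n; case: (HB n).
- by move=> n; case: (HB n).
- by apply: cvg2 => n; have [a b c d] := HB n => //; have := nrmD (A n) (B n); lra.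
- by apply: cvg2 => n; have [a b c d] := HB n => //; have := nrmB (A n) (B n); lra.
Qed.

Lemma near_square_completion (V : lmodType K) (p : seminorm V) :
  near_square (@nrm R k (completion p)) <-> near_square p.
Proof.
split; apply: near_square_approx => e x y e0.
  have e20 : 0 < e / 2 by rewrite divr_gt0.
  have [x' xx'] := to_completion_dense x e20.
  have [y' yy'] := to_completion_dense y e20.
  exists x', y'; rewrite -!(nrm_to_completion p) !linearD !linearN.
  have tri (a b : completion p) : nrm b <= nrm a + nrm (a - b).
    by have := nrmB a (a - b); rewrite subKr.
  have tri' (a b : completion p) : nrm a <= nrm b + nrm (a - b).
    by have := nrmD b (a - b); rewrite addrC subrK.
  have D := nrmD (x - to_completion p x') (y - to_completion p y').
  have B := nrmB (x - to_completion p x') (y - to_completion p y').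
  split.
  - have := tri x (to_completion p x'); lra.
  - have := tri y (to_completion p y'); lra.
  - have := tri' (x + y) (to_completion p x' + to_completion p y').
    rewrite opprD addrACA; lra.
  - have := tri' (x - y) (to_completion p x' - to_completion p y').
    rewrite opprD addrACA -opprD; lra.
exists (to_completion p x), (to_completion p y).
rewrite -linearD -linearB !nrm_to_completion; split; lra.
Qed.

End NormedSquares.

(** * Finite-rank operators and frames *)

Section FiniteRank.
Variables (R : realType) (k : scalar_kind).
Local Notation K := (scalar_field R k).

Lemma opnorm_le_ball (E Z : normedModType K) (f : bounded_op E Z) (M : R) :
  (forall x, nrm x <= 1 -> nrm (f x) <= M) -> nrm f <= M.
Proof.
move=> fM; rewrite nrm_bop; apply: ge_sup; first by case: (opnorm_has_sup f).
by move=> _ [x /= x1 <-]; exact: fM.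
Qed.

Lemma opnorm_approx (E Z : normedModType K) (f : bounded_op E Z) (e : R) :
  0 < e -> exists2 x, nrm x <= 1 & nrm f - e <= nrm (f x).
Proof.
move=> e0; have [_ [x /= x1 <-] fx] := sup_adherent e0 (opnorm_has_sup f).
by exists x; rewrite // nrm_bop ltW.
Qed.

Lemma le_nrm_bop (E Z : normedModType K) (f : bounded_op E Z) x :
  nrm (f x) <= nrm f * nrm x.
Proof. by rewrite nrm_bop le_opnorm. Qed.

Lemma le_nrm_contraction (E Z : normedModType K) (f : bounded_op E Z) x :
  nrm f <= 1 -> nrm (f x) <= nrm x.
Proof. by move=> f1; rewrite (le_trans (le_nrm_bop f x))// ler_piMl ?nrm_ge0. Qed.

Lemma bounded_op_of (E Z : normedModType K) (f : E -> Z) (M : R) :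
  linear f -> (forall x, nrm (f x) <= M * nrm x) ->
  exists F : bounded_op E Z, F =1 f.
Proof.
move=> lf fM; have fP : f \in @bounded_linear R k E Z.
  by apply/asboolP; split => //; exists M.
by exists (BoundedOp fP).
Qed.

Lemma norming_functional (E : normedModType K) (x : E) :
  exists2 f : dual_space E, nrm f <= 1 & re (f x : K) = nrm x.
Proof.
have [f [f1 fx]] := hahn_banach (Seminorm (@nrmD R k E) (@nrmZ R k E)) x.
have [||F Ff] := @bounded_op_of E (K^o) f 1.
- exact: linearP.
- by move=> z; rewrite mul1r f1.
exists F; last by rewrite Ff.
by apply: opnorm_le_ball => z z1; rewrite Ff (le_trans (f1 z)).
Qed.

Section Operators.
Variables E Z : normedModType K.

Lemma finite_rank_bound (t : seq (dual_space E * Z)) x :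
  nrm (\sum_(u <- t) (u.1 x : K) *: u.2) <=
  (\sum_(u <- t) nrm u.1 * nrm u.2) * nrm x.
Proof.
rewrite mulr_suml.
elim/big_rec2: _ => [|u a b _ ab]; first by rewrite nrm0.
rewrite (le_trans (nrmD _ _))// lerD// nrmZ mulrAC.
by rewrite ler_wpM2r ?nrm_ge0// le_nrm_bop.
Qed.

Lemma finite_rank_subproof (t : seq (dual_space E * Z)) :
  (fun x => \sum_(u <- t) (u.1 x : K) *: u.2) \in @bounded_linear R k E Z.
Proof.
apply/asboolP; split=> [a x y|].
  rewrite scaler_sumr -big_split; apply: eq_bigr => u _.
  by rewrite linearP scalerDl -scalerA.
by exists (\sum_(u <- t) nrm u.1 * nrm u.2) => x; exact: finite_rank_bound.
Qed.

Definition finite_rank (t : seq (dual_space E * Z)) : bounded_op E Z :=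
  BoundedOp (finite_rank_subproof t).

Lemma finite_rankE t x :
  finite_rank t x = \sum_(u <- t) (u.1 x : K) *: u.2.
Proof. by []. Qed.

Lemma nrm_finite_rank_le (t : seq (dual_space E * Z)) :
  nrm (finite_rank t) <= \sum_(u <- t) nrm u.1 * nrm u.2.
Proof.
apply: opnorm_le_ball => x x1; rewrite (le_trans (finite_rank_bound t x))//.
by rewrite ler_piMr// sumr_ge0// => u _; rewrite mulr_ge0 ?nrm_ge0.
Qed.

End Operators.

Arguments finite_rank : simpl never.

(** A resolution of the identity by bounded functionals.  Unlike a basis it needs
    no independence, and it provides the continuous coordinates that are all that
    the proof takes from finite dimension. *)
Definition frame (E : normedModType K) (t : seq (dual_space E * E)) :=
  forall x, finite_rank t x = x.

(** Induction on [s].  Let [q] be the identity minus the finite-rank operator of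
    a list [t] that is good for [s].  Either [q v = 0] and [t] is good for [v]
    too, or [f \o q], with [f] norming [q v], is a bounded functional that
    vanishes on [s] but not at [v], and it carries the new coordinate along
    [q v]. *)
Lemma frame_on_seq (E : normedModType K) (s : seq E) :
  exists t : seq (dual_space E * E), {in s, forall x, finite_rank t x = x}.
Proof.
elim: s => [|v s [t ts]]; first by exists [::].
pose q x := x - finite_rank t x.
have [qv0|qv] := eqVneq (q v) 0.
  exists t => x; rewrite inE => /predU1P[->|]; last exact: ts.
  by apply/esym/eqP; rewrite -subr_eq0 -/(q v) qv0.
have [f f1 fqv] := norming_functional (q v).
have fqv0 : (f (q v) : K) != 0.
  apply: contra_neq qv => fqv0; apply: nrm_eq0.
  by rewrite -fqv [X in re X]fqv0 re0.
(* [g] is normalised by [f (q v)], so that it takes the value 1 at [v] *)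
pose g x : K^o := (f (q v) : K)^-1 *: (f (q x)).
have lq : linear q.
  by move=> a x y; rewrite /q linearP opprD addrACA -scalerBr.
have [||G Gg] := @bounded_op_of E K^o g
    (nrm ((f (q v) : K)^-1 : K^o) * (1 + nrm (finite_rank t))).
- by move=> a x y; rewrite /g lq linearP scalerDr !scalerA mulrC.
- move=> x; rewrite nrmZ -mulrA ler_wpM2l ?nrm_ge0//.
  rewrite (le_trans (le_nrm_contraction _ f1))// (le_trans (nrmB _ _))//.
  by rewrite mulrDl mul1r lerD2l le_nrm_bop.
exists ((G, q v) :: t) => x; rewrite finite_rankE big_cons -finite_rankE/= Gg.
rewrite inE => /predU1P[->|xs].
  by rewrite /g [_ *: _ : K^o]mulVf// scale1r subrK.
have qx0 : q x = 0 by rewrite /q ts// subrr.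
by rewrite /g qx0 linear0 scaler0 scale0r add0r; exact: ts.
Qed.

Lemma finite_dim_frame (E : normedModType K) : finite_dim E ->
  exists t : seq (dual_space E * E), frame t.
Proof.
move=> [n [e eE]]; have [t te] := frame_on_seq [seq e i | i : 'I_n].
exists t => x; have [c ->] := eE x; rewrite linear_sum; apply: eq_bigr => i _.
by rewrite linearZ; congr (_ *: _); apply: te; rewrite map_f// mem_enum.
Qed.

Lemma bop_eval_exists (E Z : normedModType K) (x : E) :
  exists F : bounded_op (bounded_op E Z) Z, forall f, F f = f x.
Proof.
have [//|f|F Ff] := @bounded_op_of (bounded_op E Z) Z (fun f => f x) (nrm x).
- by rewrite mulrC le_nrm_bop.
- by exists F.
Qed.

Lemma bop_sum (E Z : normedModType K) (I : Type) (r : seq I)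
    (F : I -> bounded_op E Z) x : (\sum_(i <- r) F i) x = \sum_(i <- r) F i x.
Proof. exact: (big_morph (fun f : bounded_op E Z => f x)). Qed.

Definition eval_at (E : normedModType K) (x : E) : dual_space (dual_space E) :=
  sval (cid (bop_eval_exists K^o x)).

Lemma eval_atE (E : normedModType K) (x : E) (f : dual_space E) :
  eval_at x f = f x.
Proof. by rewrite /eval_at; case: cid => F /= ->. Qed.

(** Transposing the identity [x = \sum_(u <- t) u.1 x *: u.2]. *)
Lemma dual_frame (E : normedModType K) (t : seq (dual_space E * E)) :
  frame t -> frame [seq (eval_at u.2, u.1) | u <- t].
Proof.
move=> tE f; rewrite finite_rankE big_map; apply: bop_eqP => x.
rewrite bop_sum -[in RHS](tE x) finite_rankE linear_sum; apply: eq_bigr => u _.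
rewrite [RHS]linearZ.
change ((eval_at u.2 f : K) * (u.1 x : K) = (u.1 x : K) * (f u.2 : K)).
by rewrite eval_atE mulrC.
Qed.

End FiniteRank.

(** * The injective tensor product *)

Section InjectiveTensor.
Variables (R : realType) (k : scalar_kind).
Local Notation K := (scalar_field R k).
Variables X Y : normedModType K.

(** [T] is the operator [g |-> \sum g y_j *: x_j] attached to
    [w = \sum x_j (x) y_j].  Being a relation, it is insensitive to the choice
    of the decomposition of [w]. *)
Definition represents (T : bounded_op (dual_space Y) X) (w : tensor X Y) :=
  forall (f : dual_space X) (g : dual_space Y),
    f (T g) = w (form_prod f g).

Lemma tensorB (w z : tensor X Y) B : (w - z) B = w B - z B.
Proof. by []. Qed.

Lemma representsD T S w z :
  represents T w -> represents S z -> represents (T + S) (w + z).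
Proof. by move=> Tw Sz f g; rewrite bopD linearD tensorD -Tw -Sz. Qed.

Lemma representsB T S w z :
  represents T w -> represents S z -> represents (T - S) (w - z).
Proof.
by move=> Tw Sz f g; rewrite bopD bopN linearB tensorB -Tw -Sz.
Qed.

(** The injective norm is the operator norm, because functionals norm [X]. *)
Lemma represents_nrm T w : represents T w -> nrm T = inj_norm w.
Proof.
move=> Tw; apply/le_anti/andP; split.
  apply: opnorm_le_ball => g g1; have [f f1 <-] := norming_functional (T g).
  by rewrite (le_trans (re_le_nrm _))// Tw le_inj_norm.
apply: inj_norm_le => f g f1 g1; rewrite -Tw.
rewrite (le_trans (le_nrm_contraction _ f1))//.
by rewrite (le_trans (le_nrm_bop _ _))// ler_piMr ?nrm_ge0.
Qed.

Lemma tensor_represented w : exists T, represents T w.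
Proof.
have [s ->] := tensor_tsum w.
exists (finite_rank [seq (eval_at u.2, u.1) | u <- s]) => f g.
rewrite finite_rankE big_map linear_sum tsumE; apply: eq_bigr => u _.
rewrite eval_atE [LHS]linearZ; exact: mulrC.
Qed.

(** Inverting [w |-> T] is where the finite dimension of [Y] enters: a frame
    writes [T] as the finite sum of the [g |-> g u.2 *: T u.1]. *)
Lemma frame_represents (t : seq (dual_space Y * Y)) : frame t ->
  forall T, exists w, represents T w.
Proof.
move=> tY T; exists (tsum [seq (T u.1, u.2) | u <- t]) => f g.
rewrite -{1}(dual_frame tY g) finite_rankE big_map tsumE big_map !linear_sum.
apply: eq_bigr => u _; rewrite eval_atE linearZ [LHS]linearZ; exact: mulrC.
Qed.

Lemma near_square_inj : finite_dim Y ->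
  near_square (@inj_norm R k X Y) <->
  near_square (@nrm R k (bounded_op (dual_space Y) X)).
Proof.
move=> /finite_dim_frame[t /frame_represents tT].
split; apply: near_square_approx => e u v e0.
  have [[T Tu] [S Sv]] := (tensor_represented u, tensor_represented v).
  exists T, S; rewrite (represents_nrm Tu) (represents_nrm Sv).
  rewrite (represents_nrm (representsD Tu Sv)).
  by rewrite (represents_nrm (representsB Tu Sv)) !lerDl ltW.
have [[w uw] [z vz]] := (tT u, tT v); exists w, z.
rewrite -(represents_nrm uw) -(represents_nrm vz).
rewrite -(represents_nrm (representsD uw vz)).
by rewrite -(represents_nrm (representsB uw vz)) !lerDl ltW.
Qed.

End InjectiveTensor.

(** * The projective tensor product *)

Section ProjectiveTensor.
Variables (R : realType) (k : scalar_kind).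
Local Notation K := (scalar_field R k).
Variables X Y : normedModType K.
Implicit Types (T S : bounded_op Y (dual_space X)) (w : tensor X Y).

Definition op_form T (x : X) (y : Y) : K^o := (T y : dual_space X) x.

Lemma op_form_bilinear T : bilinear_for *:%R *:%R (op_form T).
Proof.
by split=> [y|x] a u v; rewrite /op_form linearP.
Qed.

HB.instance Definition _ T := bilinear_isBilinear.Build K X Y K^o *:%R *:%R
  (op_form T) (op_form_bilinear T).

Lemma op_formD T S x y : op_form (T + S) x y = op_form T x y + op_form S x y.
Proof. exact: (@bopD R k X K^o (T y) (S y)). Qed.

Lemma tensor_op_formD w T S :
  w (op_form (T + S)) = w (op_form T) + w (op_form S).
Proof.
have [s ->] := tensor_tsum w; rewrite !tsumE -big_split; apply: eq_bigr => u _.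
exact: op_formD.
Qed.

(** The duality in which bounded operators from [Y] to the dual of [X] are the
    dual of the projective tensor product. *)
Definition trace_pairing w T : R := re (w (op_form T) : K).

Lemma trace_pairing_bound w T :
  nrm (w (op_form T) : K^o) <= proj_norm w * nrm T.
Proof.
have rep s : w = tsum s ->
    nrm (w (op_form T) : K^o) <= nrm T * \sum_(u <- s) nrm u.1 * nrm u.2.
  move=> ->; rewrite tsumE mulr_sumr.
  elim/big_rec2: _ => [|u a b _ ab]; first by rewrite nrm0.
  rewrite (le_trans (nrmD _ _))// lerD// (le_trans (le_nrm_bop _ _))//.
  by rewrite [nrm u.1 * _]mulrC mulrA ler_wpM2r ?nrm_ge0// le_nrm_bop.
have [T0|T0] := eqVneq (nrm T) 0.
  by have [s /rep] := tensor_tsum w; rewrite T0 mul0r mulr0.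
have {}T0 : 0 < nrm T by rewrite lt_neqAle eq_sym T0 nrm_ge0.
rewrite -ler_pdivrMr//; apply: le_proj_norm => s /rep.
by rewrite ler_pdivrMr// mulrC.
Qed.

Lemma tprodPl a x x' (y : Y) :
  tprod (a *: x + x' : X) y = a *: tprod x y + tprod x' y.
Proof.
by apply: tensor_eqP => B; rewrite tensorD tensorZ /= linearDl linearZl_LR.
Qed.

Lemma tprodPr (x : X) a y (y' : Y) :
  tprod x (a *: y + y') = a *: tprod x y + tprod x y'.
Proof. by apply: tensor_eqP => B; rewrite tensorD tensorZ /= linearPr. Qed.

(** A functional that is bounded by the projective norm comes from the operator
    [y |-> (x |-> f (x (x) y))]. *)
Lemma proj_functional_op (f : {linear tensor X Y -> K^o}) :
  (forall w, nrm (f w) <= proj_norm w) ->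
  exists2 T, nrm T <= 1 & forall w, w (op_form T) = f w.
Proof.
move=> f1.
have fxy x y : nrm (f (tprod x y)) <= nrm x * nrm y.
  rewrite (le_trans (f1 _))//.
  by have := proj_norm_le [:: (x, y)]; rewrite /tsum !big_seq1.
have ex y : exists g : dual_space X, forall x, g x = f (tprod x y).
  have [||g gE] := @bounded_op_of R k X K^o (fun x => f (tprod x y)) (nrm y).
  - by move=> a x x'; rewrite tprodPl linearP.
  - by move=> x; rewrite mulrC fxy.
  by exists g.
have [T0 T0E] := choice ex.
have T01 y : nrm (T0 y) <= 1 * nrm y.
  rewrite mul1r; apply: opnorm_le_ball => x x1; rewrite T0E (le_trans (fxy x y))//.
  by rewrite ler_piMl ?nrm_ge0.
have [|T TE] := bounded_op_of _ T01.
  move=> a y y'; apply: bop_eqP => x.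
  by rewrite T0E tprodPr linearP -!T0E.
exists T.
  by apply: opnorm_le_ball => y y1; rewrite TE (le_trans (T01 y))// mul1r.
move=> w; have [s ->] := tensor_tsum w.
rewrite tsumE linear_sum; apply: eq_bigr => u _.
by rewrite -T0E; congr (bop_fun _ _); exact: TE.
Qed.

(** Self-duality of near squares applies both ways: tensors are normed by
    operators, by the Hahn-Banach theorem for the projective seminorm, and
    operators are normed by elementary tensors, by definition of the norm. *)
Lemma near_square_proj : near_square (@proj_norm R k X Y) <->
  near_square (@nrm R k (bounded_op Y (dual_space X))).
Proof.
have pairD w T S :
    trace_pairing w (T + S) = trace_pairing w T + trace_pairing w S.
  by rewrite /trace_pairing tensor_op_formD reD.
have pairB w T S :
    trace_pairing w (T - S) = trace_pairing w T - trace_pairing w S.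
  by apply/eqP; rewrite eq_sym subr_eq -pairD subrK.
have bound w T : `|trace_pairing w T| <= proj_norm w * nrm T.
  rewrite (le_trans _ (trace_pairing_bound w T))// ler_norml.
  by rewrite re_le_nrm lerNl -reN -(nrmN (_ : K^o)) re_le_nrm.
split.
  apply: (near_square_dual (b := trace_pairing)) => //.
  - by move=> v v' w; rewrite -reD.
  - by move=> v v' w; rewrite -reN -reD.
  - exact: proj_norm_ge0.
  - exact: nrm_ge0.
  move=> w e e0; have [f [f1 fw]] := hahn_banach (proj_seminorm X Y) w.
  have [T T1 TE] := proj_functional_op f1; exists T => //.
  by rewrite /trace_pairing TE [X in _ <= X]fw gerBl ltW.
apply: (near_square_dual (b := fun T w => trace_pairing w T)) => //.
- by move=> v v' w; rewrite -reD.
- by move=> v v' w; rewrite -reN -reD.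
- exact: nrm_ge0.
- exact: proj_norm_ge0.
- by move=> T w; rewrite mulrC.
move=> T e e0; have e20 : 0 < e / 2 by rewrite divr_gt0.
have [y y1 Ty] := opnorm_approx T e20.
have [x x1 Tyx] := opnorm_approx (T y) e20.
have [a a1 ax] := phase (T y x : K).
exists (tprod (a *: x) y).
  have := proj_norm_le [:: (a *: x, y)]; rewrite /tsum !big_seq1 => /le_trans; apply.
  by rewrite /= nrmZ a1 mul1r mulr_ile1 ?nrm_ge0.
rewrite /trace_pairing /= /op_form linearZ [X in _ <= X]ax.
have : nrm (T y) = nrm (T y : bounded_op X K^o) by [].
lra.
Qed.

End ProjectiveTensor.

(** * Ultraproducts of operators on a finite-dimensional space *)

(** Here [T] is an arbitrary type: index sets of ultrafilters carry no topology. *)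
Lemma le_cvg {T : Type} {F : set_system T} {FF : ProperFilter F}
    {R : realType} (f g : T -> R) (l l' : R) :
  f x @[x --> F] --> l -> g x @[x --> F] --> l' -> (\near F, f F <= g F) ->
  l <= l'.
Proof.
move=> fl gl fg; rewrite -subr_ge0.
by apply: (cvgr_to_ge (cvgB gl fl)); apply: filterS fg => x /=; rewrite subr_ge0.
Qed.

Section UltraLimits.
Variables (R : realType) (k : scalar_kind).
Local Notation K := (scalar_field R k).
Variables (I : Type) (U : set_system I) (hU : UltraFilter U).

Lemma ultra_bounded_real_cvg (u : I -> R) (M : R) :
  (forall i, `|u i| <= M) -> exists l : R, u i @[i --> U] --> l.
Proof.
move=> uM; have FF : ProperFilter (u i @[i --> U]) by apply: fmap_proper_filter.
have [|l [_ cl]] := @segment_compact R (- M) M (u i @[i --> U]) FF.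
  by apply: nearW => i /=; rewrite in_itv /= -ler_norml.
exists l => A Al.
have [//|nA] := in_ultra_setVsetC (u @^-1` A) hU.
by have [r [nAr Ar]] := cl (~` A) A nA Al.
Qed.

Lemma ultra_bounded_scalar_cvg (z : I -> K) (M : R) :
  (forall i, nrm (z i : K^o) <= M) ->
  exists l : K, nrm (z i - l : K^o) @[i --> U] --> (0 : R).
Proof.
have cvg0 (u : I -> R) (l : R) : u i @[i --> U] --> l ->
    `|u i - l| @[i --> U] --> (0 : R).
  move=> ul; rewrite -(normr0 R) -(subrr l).
  by apply: cvg_norm; apply: cvgB => //; exact: cvg_cst.
case: k z => /= z zM.
  have [l zl] := ultra_bounded_real_cvg zM.
  by exists l; exact: cvg0.
have re_le (w : R[i]%C) : `|complex.Re w| <= @nrm R ComplexScalars (R[i]%C)^o w.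
  change (`|complex.Re w| <= complex.Re `|w : R[i]%C|); rewrite normc_def.
  by case: w => a b /=; rewrite -sqrtr_sqr ler_wsqrtr// lerDl sqr_ge0.
have im_le (w : R[i]%C) : `|complex.Im w| <= @nrm R ComplexScalars (R[i]%C)^o w.
  change (`|complex.Im w| <= complex.Re `|w : R[i]%C|); rewrite normc_def.
  by case: w => a b /=; rewrite -sqrtr_sqr ler_wsqrtr// lerDr sqr_ge0.
have [a za] := ultra_bounded_real_cvg (fun i => le_trans (re_le (z i)) (zM i)).
have [b zb] := ultra_bounded_real_cvg (fun i => le_trans (im_le (z i)) (zM i)).
exists (a +i* b)%C.
have nrm_le (w : R[i]%C) : @nrm R ComplexScalars (R[i]%C)^o w <=
    `|complex.Re w| + `|complex.Im w|.
  change (complex.Re `|w : R[i]%C| <= `|complex.Re w| + `|complex.Im w|).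
  rewrite normc_def; case: w => c d /=.
  rewrite -[leRHS]ger0_norm ?addr_ge0// -sqrtr_sqr ler_wsqrtr//.
  rewrite -(real_normK (num_real c)) -(real_normK (num_real d)).
  by have := mulr_ge0 (normr_ge0 c) (normr_ge0 d); lra.
have lim0 : `|complex.Re (z i) - a| + `|complex.Im (z i) - b| @[i --> U] --> (0 : R).
  by rewrite -(addr0 0); apply: cvgD; exact: cvg0.
apply: (squeeze_cvgr _ (cvg_cst (0 : R)) lim0); apply: nearW => i.
apply/andP; split; first exact: (@nrm_ge0 R ComplexScalars (R[i]%C)^o).
by apply: (le_trans (nrm_le _)); case: (z i).
Qed.

(** Compactness of the balls of a finite-dimensional space, one coordinate at a
    time: along an ultrafilter each bounded coordinate converges. *)
Lemma ultra_finite_rank_cvg (E : normedModType K)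
    (t : seq (dual_space E * E)) (x : I -> E) (M : R) :
  (forall i, nrm (x i) <= M) ->
  exists l, nrm (finite_rank t (x i) - l) @[i --> U] --> (0 : R).
Proof.
move=> xM; elim: t => [|u t [l IH]].
  exists 0; rewrite (_ : (fun i => _) = cst 0); first exact: cvg_cst.
  by apply/funext => i; rewrite finite_rankE big_nil subrr nrm0.
have [|c uc] := @ultra_bounded_scalar_cvg (fun i => u.1 (x i)) (nrm u.1 * M).
  by move=> i; rewrite (le_trans (le_nrm_bop _ _))// ler_wpM2l ?nrm_ge0.
exists (c *: u.2 + l).
have lim0 : nrm ((u.1 (x i) : K) - c : K^o) * nrm u.2 +
    nrm (finite_rank t (x i) - l) @[i --> U] --> (0 : R).
  rewrite -(addr0 0); apply: cvgD => //.
  by rewrite -(mul0r (nrm u.2)); apply: cvgMr_tmp.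
apply: (squeeze_cvgr _ (cvg_cst (0 : R)) lim0); apply: nearW => i.
rewrite nrm_ge0 finite_rankE big_cons -finite_rankE opprD addrACA -scalerBl.
by rewrite (le_trans (nrmD _ _))// nrmZ.
Qed.

End UltraLimits.

Section UltraOperators.
Variables (R : realType) (k : scalar_kind).
Local Notation K := (scalar_field R k).
Variables (I : Type) (U : set_system I) (hU : UltraFilter U).
Variables E Z : normedModType K.
Implicit Types (A B : bounded_op E (ultrapower hU Z)) (T S : I -> bounded_op E Z).

(** [A] is the ultraproduct of the operators [T i]. *)
Definition induces T A := forall x, exists z : bounded_family I Z,
  (forall i, z i = T i x) /\ A x = to_sep (ultra_seminorm hU Z) z.

Lemma inducesD T S A B : induces T A -> induces S B ->
  induces (fun i => T i + S i) (A + B).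
Proof.
move=> TA SB x; have [[z [zT Az]] [y [yS By]]] := (TA x, SB x).
exists (z + y); split; first by move=> i; rewrite bopD -zT -yS.
by rewrite bopD Az By to_sepD.
Qed.

Lemma inducesB T S A B : induces T A -> induces S B ->
  induces (fun i => T i - S i) (A - B).
Proof.
move=> TA SB x; have [[z [zT Az]] [y [yS By]]] := (TA x, SB x).
exists (z - y); split; first by move=> i; rewrite bopD bopN -zT -yS.
by rewrite bopD bopN Az By linearB.
Qed.

Lemma induces_cvg T A (TA : induces T A) x :
  nrm (T i x) @[i --> U] --> nrm (A x).
Proof.
have [z [zT ->]] := TA x; rewrite nrm_to_sep.
rewrite (_ : (fun i => _) = fun i => nrm (z i)); first exact: ultra_norm_cvg.
by apply/funext => i; rewrite zT.
Qed.

(** That the norm is at most the limit is clear pointwise.  Conversely let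
    [x i] almost attain the norm of [T i]; in finite dimension the [x i] converge
    along [U] to a point [y] of the unit ball, and [T i y] is as large as
    [T i (x i)] in the limit because the [T i] are uniformly bounded. *)
Lemma induces_nrm (t : seq (dual_space E * E)) T A (M : R) : frame t ->
  (forall i, nrm (T i) <= M) -> induces T A ->
  nrm (T i) @[i --> U] --> nrm A.
Proof.
move=> tE TM TA; have PU : ProperFilter U by exact: ultra_proper.
have [|L TL] := ultra_bounded_real_cvg hU (u := fun i => nrm (T i)) (M := M).
  by move=> i; rewrite ger0_norm ?nrm_ge0.
suff -> : nrm A = L by [].
apply/le_anti/andP; split.
  apply: opnorm_le_ball => x x1.
  apply: (le_cvg (induces_cvg (x := x) TA) TL); apply: nearW => i.
  by rewrite (le_trans (le_nrm_bop _ _))// ler_piMr ?nrm_ge0.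
apply/ler_addgt0Pr => e e0.
have approx i : exists x, nrm x <= 1 /\ nrm (T i) - e <= nrm (T i x).
  by have [x x1 Tx] := opnorm_approx (T i) e0; exists x.
have [x xT] := choice approx.
have [y] := ultra_finite_rank_cvg hU t (fun i => (xT i).1).
rewrite (_ : (fun i => _) = fun i => nrm (x i - y)); last first.
  by apply/funext => i; rewrite tE.
move=> xy.
have y1 : nrm y <= 1.
  have lim1 : 1 + nrm (x i - y) @[i --> U] --> (1 : R).
    by rewrite -[X in _ --> X]addr0; apply: cvgD => //; exact: cvg_cst.
  apply: (le_cvg (cvg_cst (nrm y)) lim1); apply: nearW => i.
  have := nrmB (x i) (x i - y); rewrite subKr; have := (xT i).1; lra.
apply: (@le_trans _ _ (nrm (A y) + e)); last first.
  by rewrite lerD2r (le_trans (le_nrm_bop _ _))// ler_piMr ?nrm_ge0.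
have limA : nrm (T i y) + e + M * nrm (x i - y) @[i --> U] --> nrm (A y) + e.
  rewrite -[X in _ --> X]addr0; apply: cvgD.
    by apply: cvgD; [exact: induces_cvg|exact: cvg_cst].
  by rewrite -(mulr0 M); exact: cvgMl_tmp.
apply: (le_cvg TL limA); apply: nearW => i.
have Txy : nrm (T i (x i - y)) <= M * nrm (x i - y).
  by rewrite (le_trans (le_nrm_bop _ _))// ler_wpM2r ?nrm_ge0.
have := nrmD (T i y) (T i (x i - y)); rewrite -linearD addrC subrK.
have := (xT i).2; lra.
Qed.

Lemma bounded_induces T (M : R) : (forall i, nrm (T i) <= M) ->
  exists A, induces T A.
Proof.
move=> TM; have PU : ProperFilter U by exact: ultra_proper.
have TxM x i : nrm (T i x) <= M * nrm x.
  by rewrite (le_trans (le_nrm_bop _ _))// ler_wpM2r ?nrm_ge0.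
have Tx x : (fun i => T i x) \in @is_bounded R k I Z.
  by apply/asboolP; exists (M * nrm x) => i.
pose A0 x : ultrapower hU Z := to_sep (ultra_seminorm hU Z) (BoundedFamily (Tx x)).
have [||A AE] := @bounded_op_of R k E (ultrapower hU Z) A0 M.
- move=> a x y; rewrite /A0 -to_sepZ -to_sepD; congr to_sep.
  by apply/val_inj/funext => i /=; rewrite linearP.
- move=> x; rewrite nrm_to_sep.
  apply: (cvgr_to_le (ultra_norm_cvg hU (z := BoundedFamily (Tx x)))).
  by apply: nearW => i; exact: TxM.
by exists A => x; exists (BoundedFamily (Tx x)).
Qed.

(** Operators from a finite-dimensional space into an ultrapower are
    ultraproducts: lift the images of the vectors of a frame. *)
Lemma frame_lift (t : seq (dual_space E * E)) A : frame t ->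
  exists T, (exists M : R, forall i, nrm (T i) <= M) /\ induces T A.
Proof.
move=> tE.
have repr_ex x : exists r : bounded_family I Z,
    to_sep (ultra_seminorm hU Z) r = A x.
  by exists (repr (A x)); exact: to_sep_repr.
have [r rE] := choice repr_ex.
have bound_ex x : exists N : R, forall i, nrm (r x i) <= N.
  by case: (r x) => f fP; have /asboolP[M fM] := fP; exists M.
have [N rN] := choice bound_ex.
exists (fun i => finite_rank [seq (u.1, r u.2 i) | u <- t]); split.
  exists (\sum_(u <- t) nrm u.1 * N u.2) => i.
  rewrite (le_trans (nrm_finite_rank_le _))// big_map ler_sum// => u _ /=.
  by rewrite ler_wpM2l ?nrm_ge0.
move=> x; exists (\sum_(u <- t) (u.1 x : K) *: r u.2); split.
  move=> i; rewrite finite_rankE big_map.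
  exact: (big_morph (fun z : bounded_family I Z => z i)).
rewrite linear_sum -{1}(tE x) finite_rankE linear_sum; apply: eq_bigr => u _.
by rewrite [LHS]linearZ [RHS]linearZ; congr (_ *: _); exact/esym/rE.
Qed.

End UltraOperators.

(** A sequence of almost-squares gives an exact one along an ultrafilter finer
    than the cofinite one; an exact square lifts to operators whose norms are
    close to the required ones for some index. *)
Lemma Sq_ultra_Sq (R : realType) (k : scalar_kind)
    (E Z : normedModType (scalar_field R k)) (t : seq (dual_space E * E)) :
  frame t -> Sq E Z <-> ultra_Sq E Z.
Proof.
move=> tE; split; last first.
  move=> [I [U [hU [A [B [A1 B1 D2 B2]]]]]]; apply/Sq_near_square => e e0.
  have [T [[M TM] TA]] := frame_lift A tE.
  have [S [[N SN] SB]] := frame_lift B tE.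
  have near_nrm (C : I -> bounded_op E Z)
      (F : bounded_op E (ultrapower hU Z)) (L : R) :
      (forall i, nrm (C i) <= L) -> induces C F ->
      \forall i \near U, nrm F - e <= nrm (C i) <= nrm F + e.
    move=> CL CF; have /cvgrPdist_le/(_ e e0) := induces_nrm tE CL CF.
    by apply: filterS => i; rewrite ler_norml; lra.
  have DN i : nrm (T i + S i) <= M + N by rewrite (le_trans (nrmD _ _))// lerD.
  have BN i : nrm (T i - S i) <= M + N by rewrite (le_trans (nrmB _ _))// lerD.
  have [i [[/andP[_ Ti] /andP[_ Si]] [/andP[Di _] /andP[Bi _]]]] := filter_ex
    (filterI (filterI (near_nrm _ _ _ TM TA) (near_nrm _ _ _ SN SB))
      (filterI (near_nrm _ _ _ DN (inducesD TA SB))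
        (near_nrm _ _ _ BN (inducesB TA SB)))).
  by exists (T i), (S i); rewrite -{1}A1 -{1}B1 -{1}D2 -B2.
move=> [T [S [T1 S1 D2 B2]]].
have [U [hU oU]] := ultraFilterLemma eventually_filter.
have T1' n : nrm (T n) <= 1 by rewrite T1.
have S1' n : nrm (S n) <= 1 by rewrite S1.
have DN i : nrm (T i + S i) <= 1 + 1 by rewrite (le_trans (nrmD _ _))// lerD.
have BN i : nrm (T i - S i) <= 1 + 1 by rewrite (le_trans (nrmB _ _))// lerD.
have [A TA] := bounded_induces hU T1'.
have [B SB] := bounded_induces hU S1'.
have nrm_lim (C : nat -> bounded_op E Z)
    (F : bounded_op E (ultrapower hU Z)) (L l : R) :
    (forall i, nrm (C i) <= L) -> induces C F ->
    nrm (C n) @[n --> \oo] --> l -> nrm F = l.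
  move=> CL CF Cl; have CU : nrm (C n) @[n --> U] --> l.
    by move=> P /Cl; exact: oU.
  by rewrite -(cvg_lim _ CU)// (cvg_lim _ (induces_nrm tE CL CF)).
exists nat, U, hU, A, B; split.
- by apply: (nrm_lim _ _ _ _ T1' TA); under eq_fun do rewrite T1; exact: cvg_cst.
- by apply: (nrm_lim _ _ _ _ S1' SB); under eq_fun do rewrite S1; exact: cvg_cst.
- exact: (nrm_lim _ _ _ _ DN (inducesD TA SB) D2).
- exact: (nrm_lim _ _ _ _ BN (inducesB TA SB) B2).
Qed.

(** * The theorem *)

Theorem theorem3p10 (R : realType) (k : scalar_kind)
    (X Y : completeNormedModType (scalar_field R k)) (hY : finite_dim Y) :
  [/\ C_NJ (inj_tensor X Y) = 2 <-> Sq (dual_space Y) X,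
      C_NJ (proj_tensor X Y) = 2 <-> Sq Y (dual_space X),
      Sq (dual_space Y) X <-> ultra_Sq (dual_space Y) X &
      Sq Y (dual_space X) <-> ultra_Sq Y (dual_space X)].
Proof.
have [t tY] := finite_dim_frame hY; split.
- rewrite C_NJ_near_square Sq_near_square near_square_completion.
  exact: near_square_inj.
- rewrite C_NJ_near_square Sq_near_square near_square_completion.
  exact: near_square_proj.
- exact: Sq_ultra_Sq (dual_frame tY).
- exact: Sq_ultra_Sq tY.
Qed.
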